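(* Let $(x^*,\mu_i^*,\mu_e^* )$ be (the corresponding components of) a solution of the static problem (P), and suppose $\mu^*_{il} > \lambda_l(1-p_l)$ and $\mu^*_{el} > x_l^*$ for all $l \in \mathcal{L}$. Then for any $\epsilon>0$, under the online algorithm with parameter $\epsilon$, the total expected service deficit and network queue length is bounded by $$\limsup_{k \rightarrow \infty} E\left[ \sum_{l \in \mathcal{L}} \big(d_l(k)+q_l(k)\big) \right] \leq B_4 + \frac{1}{\epsilon} B_5,$$ where $$B_4 = \frac{B_1}{ \min \{ B_2, B_3 \} }, \qquad B_5 \leq \frac{ \sum_{l \in \mathcal{L}} \left( \max_{ 0 \leq x_l \leq X_{max} } 2 |U_l(x_l)| + w_l \lambda_l \right)}{ \min \{ B_2, B_3 \} },$$ and $B_1,B_2,B_3$ are the positive constants given in the context.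
   Context: Network. $\mathcal{L}$ is a finite set of links, with given interference constraints specifying which pairs of links may transmit simultaneously. Time is slotted and $T$ consecutive slots form a frame. In each frame $k$, $a_i(k)=(a_{il}(k))_{l\in\mathcal{L}}$ is the (nonnegative integer) vector of inelastic packet arrivals, with $a_{il}(k)$ of mean $\lambda_l$ and variance $\sigma_{il}^2$, $\Pr(a_{il}=0)>0$, $\Pr(a_{il}=1)>0$; $c(k)=(c_l(k))_{l\in\mathcal{L}}$ is the channel state, $c_l(k)\ge 0$ being the number of packets link $l$ can transmit per slot in the frame, with mean $\bar c_l$ and variance $\sigma_{cl}^2$. Both are independent across frames with the same distribution in every frame, and channels are independent of arrivals. $\Pr(a_i)$, $\Pr(c)$ denote their distributions. The channel state is known at the beginning of the frame. Inelastic packets not served in their frame are discarded; $p_l\in[0,1]$ is the maximal allowed loss probability at link $l$. $U_l$ is a concave utility function of the mean elastic arrival rate $x_l\ge 0$ per frame, and $w\in\mathbb{R}_+^{|\mathcal{L}|}$ is a given weight vector. Schedules. $\mathcal{S}(a_i,c)$ is the set of feasible schedules $s=(s_{il,t},s_{el,t})_{l\in\mathcal{L},1\le t\le T}$, with $s_{il,t},s_{el,t}$ nonnegative integers (numbers of inelastic and elastic packets scheduled on link $l$ in slot $t$), such that in each slot any two links with $s_{il,t}+s_{el,t}>0$ do not interfere, $\sum_{t=1}^T s_{il,t}\le a_{il}$ for all $l$, and $s_{il,t}+s_{el,t}\le c_l$ for all $l,t$. Static problem (P). Maximize $\sum_{l}(U_l(x_l)+w_l\mu_{il})$ over $\mu_i(a_i,c),\mu_e(a_i,c),\mu_i,\mu_e,x,\Pr(s|a_i,c)$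 subject to, for all $l\in\mathcal{L}$ and all $a_i,c$: $\mu_{il}(a_i,c)\le\sum_{s\in\mathcal{S}(a_i,c)}\sum_{t=1}^T s_{il,t}\Pr(s|a_i,c)$; $\mu_{el}(a_i,c)\le\sum_{s\in\mathcal{S}(a_i,c)}\sum_{t=1}^T s_{el,t}\Pr(s|a_i,c)$; $\mu_{il}=\sum_{a_i}\sum_c\mu_{il}(a_i,c)\Pr(c)\Pr(a_i)$; $\mu_{el}=\sum_{a_i}\sum_c\mu_{el}(a_i,c)\Pr(c)\Pr(a_i)$; $\mu_{il}\ge\lambda_l(1-p_l)$; $0\le x_l\le\mu_{el}$; $\Pr(s|a_i,c)\ge0$; $\sum_{s}\Pr(s|a_i,c)\le1$. Problem (P) is assumed to have a solution; starred quantities $x^*,\mu_i^*,\mu_e^*$ denote components of a solution. Online algorithm with parameter $\epsilon>0$ and fixed $X_{max}>\max_l x_l^*$. The state in frame $k$ is $(d(k),q(k))$, $d_l(k),q_l(k)\ge0$ (deficit counters and elastic queue lengths). Congestion controller: $\tilde x_l^*(k)\in\arg\max_{0\le x_l\le X_{max}}\frac1\epsilon U_l(x_l)-q_l(k)x_l$ (maximizers assumed to exist). Scheduler: $\tilde s^*(a_i(k),c(k),d(k),q(k))\in\arg\max_{s\in\mathcal{S}(a_i(k),c(k))}\sum_{l}\{[\frac1\epsilon w_l+d_l(k)]\sum_{t=1}^T s_{il,t}+q_l(k)\sum_{t=1}^T s_{el,t}\}$. Put $I_{il}^*=\sum_{t=1}^T\tilde s^*_{il,t}$ and $I_{el}^*=\sum_{t=1}^T\tilde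 s^*_{el,t}$ (functions of $(a_i(k),c(k),d(k),q(k))$). Updates: $d_l(k+1)=[d_l(k)+\tilde a_{il}(k)-I_{il}^*]^+$, $q_l(k+1)=[q_l(k)+\tilde a_{el}(k)-I_{el}^*]^+$, where $\alpha^+=\max\{\alpha,0\}$; $\tilde a_{il}(k)$ is, given $a_{il}(k)$, binomial with parameters $a_{il}(k)$ and $1-p_l$ (independent coin tosses); $\tilde a_{el}(k)$ is a nonnegative-integer random variable with (conditional on the state) mean $\tilde x_l^*(k)$ and variance at most a fixed constant $\sigma_e^2$, with $\Pr(\tilde a_{el}(k)=0)>0$ and $\Pr(\tilde a_{el}(k)=1)>0$. Under these assumptions $(d(k),q(k))$ is taken to be an irreducible aperiodic Markov chain. The initial state satisfies $E[V(d(1),q(1))]<\infty$ with $V(d,q)=\frac12\sum_{l}(d_l^2+q_l^2)$. Constants. $B_1=\frac12\sum_{l}\{(\lambda_l^2+\sigma_{il}^2)[1+(1-p_l)^2]+\lambda_lp_l(1-p_l)\}+\frac12\sum_{l}\{X_{max}^2+\sigma_e^2+(\bar c_l^2+\sigma_{cl}^2)T^2\}$, $B_2=\min_{l}\{\mu^*_{il}-\lambda_l(1-p_l)\}$, $B_3=\min_{l}\{\mu^*_{el}-x_l^*\}$. *)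

(* Defs.v *)
From HB Require Import structures.
From mathcomp Require Import all_boot all_order all_algebra.
From mathcomp Require Import all_classical all_reals all_analysis.
Import Order.TTheory GRing.Theory Num.Theory.
Import numFieldNormedType.Exports.

Set Implicit Arguments.
Unset Strict Implicit.
Unset Printing Implicit Defensive.

Local Open Scope classical_set_scope.
Local Open Scope ring_scope.

(* [\esum] is meaningful for nonnegative terms only; a signed family is summed
   as the difference of its two parts, under absolute summability. *)
Definition has_sum (R : realType) (I : choiceType) (f : I -> R) (m : R) : Prop :=
  summable [set: I] (EFin \o f) /\
  (\esum_(i in [set: I]) (EFin \o f)^\+ i
     - \esum_(i in [set: I]) (EFin \o f)^\- i = m%:E)%E.

Section Markov.
Variables (R : realType) (X : choiceType) (S : set X) (K : X -> X -> R).

Definition transition_matrix : Prop :=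
  forall x, S x ->
    (forall y, S y -> 0 <= K x y) /\ \esum_(y in S) (K x y)%:E = 1%E.

Fixpoint kstep (n : nat) (x y : X) : \bar R :=
  if n is n'.+1 then (\esum_(z in S) ((K x z)%:E * kstep n' z y))%E
  else (x == y)%:R%:E.

Definition irreducible_chain : Prop :=
  forall x y, S x -> S y -> exists n, (0 < kstep n x y)%E.

Definition aperiodic_chain : Prop :=
  forall x, S x -> forall m : nat,
    (forall n : nat, (0 < n)%N -> (0 < kstep n x x)%E -> (m %| n)%N) -> m = 1%N.

Definition markov_chain (d : measure_display) (Om : measurableType d)
    (P : probability Om R) (Z : nat -> Om -> X) : Prop :=
  (forall k, {ae P, forall w, S (Z k w)}) /\
  (forall (k : nat) (x : nat -> X), (forall j, S (x j)) ->
     P [set w | forall j, (j <= k.+1)%N -> Z j w = x j] =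
     (P [set w | forall j, (j <= k)%N -> Z j w = x j]
        * (K (x k) (x k.+1))%:E)%E).

End Markov.

Section Network.
Variables (R : realType) (L : finType).

Definition pvec : Type := L -> nat.

Record network := Network {
  slots : nat;                        (* T *)
  interf : rel L;
  arr_law : pvec -> R;                (* Pr(a_i) *)
  chan_law : pvec -> R;               (* Pr(c) *)
  lam : L -> R;
  sigma_i : L -> R;
  cbar : L -> R;
  sigma_c : L -> R;
  loss : L -> R;                      (* p_l *)
  util : L -> R -> R;                 (* U_l *)
  weight : L -> R                     (* w_l *)
}.

Definition packet_pmf (Q : pvec -> R) : Prop :=
  (forall v, 0 <= Q v) /\ \esum_(v in [set: pvec]) (Q v)%:E = 1%E.

Definition has_mean (Q : pvec -> R) (l : L) (m : R) : Prop :=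
  \esum_(v in [set: pvec]) ((v l)%:R * Q v)%:E = m%:E.

Definition has_variance (Q : pvec -> R) (l : L) (m s2 : R) : Prop :=
  \esum_(v in [set: pvec]) (((v l)%:R - m) ^+ 2 * Q v)%:E = s2%:E.

Record network_spec (N : network) : Prop := {
  arr_pmf : packet_pmf (arr_law N);
  arr_mean : forall l, has_mean (arr_law N) l (lam N l);
  arr_var : forall l,
    has_variance (arr_law N) l (lam N l) (sigma_i N l ^+ 2);
  arr_pos0 : forall l,
    (0 < \esum_(v in [set v : pvec | v l = 0%N]) (arr_law N v)%:E)%E;
  arr_pos1 : forall l,
    (0 < \esum_(v in [set v : pvec | v l = 1%N]) (arr_law N v)%:E)%E;
  chan_pmf : packet_pmf (chan_law N);
  chan_mean : forall l, has_mean (chan_law N) l (cbar N l);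
  chan_var : forall l,
    has_variance (chan_law N) l (cbar N l) (sigma_c N l ^+ 2);
  loss01 : forall l, 0 <= loss N l <= 1;
  util_concave : forall l,
    convex_function (`[0, +oo[ : set R^o) (fun x : R^o => - util N l x);
  weight_ge0 : forall l, 0 <= weight N l
}.

Section Schedules.
Variable N : network.

(* First component: inelastic packets; second component: elastic packets. *)
Definition schedule : Type :=
  ((L -> 'I_(slots N) -> nat) * (L -> 'I_(slots N) -> nat))%type.

Definition inel_total (s : schedule) (l : L) : nat :=
  (\sum_(t < slots N) s.1 l t)%N.
Definition el_total (s : schedule) (l : L) : nat :=
  (\sum_(t < slots N) s.2 l t)%N.

(* A finite set, so that the sums over it below are finite sums. *)
Definition feasible (a c : pvec) : set schedule :=
  [set s | [/\ forall t l l', l != l' ->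
                 (0 < s.1 l t + s.2 l t)%N -> (0 < s.1 l' t + s.2 l' t)%N ->
                 ~~ interf N l l',
               forall l, (inel_total s l <= a l)%N
             & forall l t, (s.1 l t + s.2 l t <= c l)%N]].

Record static_vars := StaticVars {
  mu_i_at : pvec -> pvec -> L -> R;   (* mu_i(a_i, c) *)
  mu_e_at : pvec -> pvec -> L -> R;   (* mu_e(a_i, c) *)
  mu_i : L -> R;
  mu_e : L -> R;
  rate : L -> R;                      (* x *)
  sched_prob : pvec -> pvec -> schedule -> R  (* Pr(s | a_i, c) *)
}.

Record static_feasible (v : static_vars) : Prop := {
  mu_i_at_le : forall a c l, mu_i_at v a c l <=
    \sum_(s \in feasible a c) ((inel_total s l)%:R * sched_prob v a c s);
  mu_e_at_le : forall a c l, mu_e_at v a c l <=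
    \sum_(s \in feasible a c) ((el_total s l)%:R * sched_prob v a c s);
  mu_iE : forall l, has_sum (fun ac : pvec * pvec =>
    mu_i_at v ac.1 ac.2 l * chan_law N ac.2 * arr_law N ac.1) (mu_i v l);
  mu_eE : forall l, has_sum (fun ac : pvec * pvec =>
    mu_e_at v ac.1 ac.2 l * chan_law N ac.2 * arr_law N ac.1) (mu_e v l);
  mu_i_ge : forall l, lam N l * (1 - loss N l) <= mu_i v l;
  rate_bounds : forall l, 0 <= rate v l <= mu_e v l;
  sched_prob_ge0 : forall a c s, feasible a c s -> 0 <= sched_prob v a c s;
  sched_prob_le1 : forall a c,
    \sum_(s \in feasible a c) sched_prob v a c s <= 1
}.

Definition static_objective (v : static_vars) : R :=
  \sum_l (util N l (rate v l) + weight N l * mu_i v l).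

Definition static_solution (v : static_vars) : Prop :=
  static_feasible v /\
  forall v', static_feasible v' -> static_objective v' <= static_objective v.

(* First component: deficit counters; second component: elastic queues. *)
Definition state : Type := ((L -> R) * (L -> R))%type.

Definition congestion_argmax (eps Xmax : R) (l : L) (x : state) (y : R) : Prop :=
  0 <= y <= Xmax /\
  forall z, 0 <= z <= Xmax ->
    eps^-1 * util N l z - x.2 l * z <= eps^-1 * util N l y - x.2 l * y.

Definition sched_weight (eps : R) (x : state) (s : schedule) : R :=
  \sum_l ((eps^-1 * weight N l + x.1 l) * (inel_total s l)%:R
          + x.2 l * (el_total s l)%:R).

Definition scheduler_argmax (eps : R) (a c : pvec) (x : state) (s : schedule) :
    Prop :=
  feasible a c s /\
  forall s', feasible a c s' -> sched_weight eps x s' <= sched_weight eps x s.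

Definition lyapunov (x : state) : R :=
  2^-1 * \sum_l (x.1 l ^+ 2 + x.2 l ^+ 2).

Section Online.
Variables (d : measure_display) (Om : measurableType d) (P : probability Om R).

(* The index [k : nat] stands for frame [k + 1]: index 0 is the first frame. *)
Record process := Process {
  arr : nat -> L -> {RV P >-> nat};        (* a_il(k) *)
  chan : nat -> L -> {RV P >-> nat};       (* c_l(k) *)
  tarr_i : nat -> L -> {RV P >-> nat};     (* \tilde a_il(k) *)
  tarr_e : nat -> L -> {RV P >-> nat};     (* \tilde a_el(k) *)
  deficit : nat -> L -> {RV P >-> R};      (* d_l(k) *)
  queue : nat -> L -> {RV P >-> R};        (* q_l(k) *)
  controller : state -> L -> R;            (* \tilde x^*_l *)
  scheduler : pvec -> pvec -> state -> schedule;  (* \tilde s^* *)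
  chain_space : set state;
  chain_kernel : state -> state -> R
}.

Definition arr_at (Z : process) (k : nat) (w : Om) : pvec :=
  fun l => arr Z k l w.
Definition chan_at (Z : process) (k : nat) (w : Om) : pvec :=
  fun l => chan Z k l w.
Definition state_at (Z : process) (k : nat) (w : Om) : state :=
  (fun l => deficit Z k l w, fun l => queue Z k l w).

Definition schedule_at (Z : process) (k : nat) (w : Om) : schedule :=
  scheduler Z (arr_at Z k w) (chan_at Z k w) (state_at Z k w).

Record online (eps Xmax sigma_e : R) (Z : process) : Prop := {
  space_countable : countable (chain_space Z);
  space_ge0 : forall x, chain_space Z x -> forall l, 0 <= x.1 l /\ 0 <= x.2 l;
  controllerP : forall x, chain_space Z x -> forall l,
    congestion_argmax eps Xmax l x (controller Z x l);
  schedulerP : forall a c x, chain_space Z x ->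
    scheduler_argmax eps a c x (scheduler Z a c x);
  (* independence and stationarity across frames, and independence of arrivals
     and channels *)
  driving_law : forall (n : nat) (av cv : nat -> pvec),
    P [set w | forall k, (k < n)%N ->
         arr_at Z k w = av k /\ chan_at Z k w = cv k] =
    (\prod_(k < n) (arr_law N (av k) * chan_law N (cv k)))%:E;
  (* arrivals and channels of a frame are independent of the states up to the
     beginning of that frame *)
  driving_indep : forall (k : nat) (x : nat -> state) (a c : pvec),
    P [set w | (forall j, (j <= k)%N -> state_at Z j w = x j) /\
               arr_at Z k w = a /\ chan_at Z k w = c] =
    (P [set w | forall j, (j <= k)%N -> state_at Z j w = x j]
       * (arr_law N a * chan_law N c)%:E)%E;
  tarr_i_law : forall (k : nat) (l : L) (x : state) (n j : nat),
    P [set w | state_at Z k w = x /\ arr Z k l w = n /\ tarr_i Z k l w = j] =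
    (P [set w | state_at Z k w = x /\ arr Z k l w = n]
       * (binomial_pmf n (1 - loss N l) j)%:E)%E;
  tarr_e_mean : forall (k : nat) (l : L) (x : state), chain_space Z x ->
    (\int[P]_(w in [set w | state_at Z k w = x]) ((tarr_e Z k l w)%:R%R)%:E =
    (controller Z x l)%:E * P [set w | state_at Z k w = x])%E;
  tarr_e_var : forall (k : nat) (l : L) (x : state), chain_space Z x ->
    (\int[P]_(w in [set w | state_at Z k w = x])
        (((tarr_e Z k l w)%:R - controller Z x l)%R ^+ 2)%:E
     <= (sigma_e ^+ 2)%:E * P [set w | state_at Z k w = x])%E;
  tarr_e_pos0 : forall k l, (0 < P [set w | tarr_e Z k l w = 0%N])%E;
  tarr_e_pos1 : forall k l, (0 < P [set w | tarr_e Z k l w = 1%N])%E;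
  deficitS : forall k l w, deficit Z k.+1 l w =
    Num.max (deficit Z k l w + (tarr_i Z k l w)%:R
               - (inel_total (schedule_at Z k w) l)%:R) 0;
  queueS : forall k l w, queue Z k.+1 l w =
    Num.max (queue Z k l w + (tarr_e Z k l w)%:R
               - (el_total (schedule_at Z k w) l)%:R) 0;
  chain_transition : transition_matrix (chain_space Z) (chain_kernel Z);
  chain_markov : markov_chain (chain_space Z) (chain_kernel Z) P (state_at Z);
  chain_irreducible : irreducible_chain (chain_space Z) (chain_kernel Z);
  chain_aperiodic : aperiodic_chain (chain_space Z) (chain_kernel Z);
  initial_moment : ('E_P[fun w => lyapunov (state_at Z 0 w)] < +oo)%E
}.

Definition mean_backlog (Z : process) (k : nat) : \bar R :=
  'E_P[fun w => (\sum_l (deficit Z k l w + queue Z k l w))%R]%E.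

End Online.

(* The minimum over the finite set of links, as an infimum in [R]. *)
Definition min_links (F : L -> R) : R := inf (range F).

Definition B1 (Xmax sigma_e : R) : R :=
  2^-1 * \sum_l ((lam N l ^+ 2 + sigma_i N l ^+ 2) * (1 + (1 - loss N l) ^+ 2)
                 + lam N l * loss N l * (1 - loss N l))
  + 2^-1 * \sum_l (Xmax ^+ 2 + sigma_e ^+ 2
                   + (cbar N l ^+ 2 + sigma_c N l ^+ 2) * (slots N)%:R ^+ 2).

Definition B2 (v : static_vars) : R :=
  min_links (fun l => mu_i v l - lam N l * (1 - loss N l)).

Definition B3 (v : static_vars) : R :=
  min_links (fun l => mu_e v l - rate v l).

Definition B4 (v : static_vars) (Xmax sigma_e : R) : R :=
  B1 Xmax sigma_e / Num.min (B2 v) (B3 v).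

(* The maximum of [2 |U_l|] over [0, Xmax] is rendered as a supremum, finite
   for concave [U_l]; the two agree whenever the maximum is attained. *)
Definition B5_bound (v : static_vars) (Xmax : R) : R :=
  (\sum_l (sup [set 2 * `|util N l x| | x in `[0, Xmax]]
           + weight N l * lam N l))
  / Num.min (B2 v) (B3 v).

End Schedules.
End Network.

(* Main.v *)
(** Scheduler and congestion-controller optimality, tested against the static
    solution, give the Foster-Lyapunov drift [K V + m f <= V + b] on the chain space,
    where [V] is the quadratic Lyapunov function, [f] the total backlog,
    [m = min B2 B3] and [b = B1 + eps^-1 * (m * B5_bound)].  Telescoping bounds only the
    time averages of [E (f (Z k))] by [b / m].  To bound the limsup itself, run two
    independent copies of the chain from [x] and [x'] until they meet: [K^n f x] exceeds
    [K^n f x'] by at most the expected value of [f + f] at time [n] on the event that they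
    have not met.  These errors are summable in [n], with sum [O (V x + V x' + 1)],
    because the product chain inherits the drift, the sublevel sets of [f] are finite, and
    irreducibility and aperiodicity make a meeting possible from every pair of states.
    Comparing the chain with its own one-step shift gives
    [E (f (Z k.+1)) <= E (f (Z k)) + r k] with [r] summable, and with the bound on the time
    averages this yields the limsup. *)
Require Import Defs.
From HB Require Import structures.
From mathcomp Require Import all_boot all_order all_algebra.
From mathcomp Require Import all_classical all_reals all_analysis.
From mathcomp Require Import measurable_realfun ring lra.
Import Order.TTheory GRing.Theory Num.Theory.
Import numFieldNormedType.Exports.

Set Implicit Arguments.
Unset Strict Implicit.
Unset Printing Implicit Defensive.

Local Open Scope classical_set_scope.
Local Open Scope ring_scope.

(** Since [f] is unbounded, convergence in law would not control its mean, so no invariant law is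
    sought. Nor is the coupled pair ever built as a process: [pair_op] acts on functions of two
    states, and any [H >= 0] with [F + pair_op H <= H] off the diagonal dominates the whole series
    of coupling errors of [F x x' = f x + f x']. Such an [H] is [2 / m] times [V x + V x'] plus
    [4 * b / m] times a bounded [h]. Scaled by [2 / m], the drift of the pair gains
    [2 * (f x + f x')] against the loss [4 * b / m]. One half of the gain is [F]; the other half
    covers the loss as soon as one backlog exceeds [4 * b / m], and on the finitely many remaining
    pairs the decrease of [h] covers it. As [H] grows only linearly in [V], the finite initial
    moment makes the errors summable under the initial law. Kernel and process are tied together
    only by probabilities of paths. Properties of the kernel at a state are therefore read off at a
    time when that state has positive probability; irreducibility provides such a time. *)

(** * Limsup of a sequence with bounded time averages and summable increases *)

Lemma limn_esup_le_near (R : realType) (u : nat -> \bar R) (c : \bar R) (N : nat) :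
  (forall n, (N <= n)%N -> (u n <= c)%E) -> (limn_esup u <= c)%E.
Proof.
move=> uc; rewrite /limn_esup /limf_esup.
apply: (@le_trans _ _ (ereal_sup (u @` [set n | (N <= n)%N]))).
  by apply: ereal_inf_lbound; exists [set n | (N <= n)%N] => //; exists N.
by apply: ge_ereal_sup => _ [n /= Nn <-]; exact: uc.
Qed.

(** If [a] stayed above [b / m + e / 2], the nonnegative [v] would decrease linearly forever. So [a]
    is below that level at some late index, and from there on it can gain only a tail of the series
    of [r]. *)
Lemma eventually_le_of_drift (R : realType) (a v r : nat -> R) (m b C : R) :
  0 < m -> (forall k, 0 <= v k) -> (forall k, 0 <= r k) ->
  (forall k, v k.+1 + m * a k <= v k + b) ->
  (forall k, a k.+1 <= a k + r k) ->
  (forall n, \sum_(0 <= k < n) r k <= C) ->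
  forall e, 0 < e -> exists N, forall n, (N <= n)%N -> a n <= b / m + e.
Proof.
move=> m0 v0 r0 drift ar rC e e0.
pose s n := \sum_(0 <= k < n) r k.
have supS : has_sup (range s).
  by split; [exists (s 0%N), 0%N|exists C => _ [n _ <-]; exact: rC].
have e20 : 0 < e / 2 by rewrite divr_gt0.
(* Past [N] the partial sums of [r] stay within [e / 2] of their supremum. *)
have [_ [N _ <-] hN] := sup_adherent e20 supS.
have tail j n : (N <= j)%N -> (j <= n)%N -> s n - s j <= e / 2.
  move=> Nj jn; have h1 : s n <= sup (range s) by apply: ub_le_sup; [exact: supS.2|exists n].
  have h2 : s N <= s j.
    by rewrite /s (big_cat_nat (n := N) (p := j))//= lerDl sumr_ge0.
  lra.
have steps j n : a (n + j)%N <= a j + (s (n + j)%N - s j).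
  elim: n => [|n ih]; first by rewrite add0n subrr addr0.
  rewrite addSn; apply: (le_trans (ar _)); rewrite [s (n + j).+1]/s big_nat_recr//= -/(s _).
  lra.
have [j Nj aj] : exists2 j, (N <= j)%N & a j <= b / m + e / 2.
  apply: contrapT => nex.
  have big j : (N <= j)%N -> b / m + e / 2 < a j.
    by move=> Nj; rewrite ltNge; apply/negP => h; apply: nex; exists j.
  have dec n : v (n + N)%N <= v N - n%:R * (m * (e / 2)).
    elim: n => [|n ih]; first by rewrite mul0r subr0.
    rewrite addSn -natr1 mulrDl mul1r.
    have := drift (n + N)%N.
    have : m * (b / m + e / 2) <= m * a (n + N)%N.
      by rewrite ler_pM2l// ltW// big// leq_addl.
    rewrite mulrDr mulrCA divff ?gt_eqF// mulr1; lra.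
  have me0 : 0 < m * (e / 2) by rewrite mulr_gt0.
  (* By this many steps the linear decrease has exhausted [v N]. *)
  have := dec (Num.truncn (v N / (m * (e / 2)))).+1.
  apply/negP; rewrite -ltNge; apply: (@lt_le_trans _ _ 0) => //.
  by rewrite subr_lt0 -ltr_pdivrMr// truncnS_gt.
exists j => n jn; rewrite -(subnK jn).
have := steps j (n - j)%N; have := tail j (n - j + j)%N Nj (leq_addl _ _); lra.
Qed.

Section Ereal.
Local Open Scope ereal_scope.

(** Finiteness of [v 0] spreads along the drift to every [v k], hence to every [a k], and the
    real-valued statement applies. *)
Lemma limn_esup_le_of_drift (R : realType) (a v r : nat -> \bar R) (m b C : R) :
  (0 < m)%R -> (forall k, 0 <= a k) -> (forall k, 0 <= v k) -> (forall k, 0 <= r k) ->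
  v 0%N < +oo ->
  (forall k, v k.+1 + m%:E * a k <= v k + b%:E) ->
  (forall k, a k.+1 <= a k + r k) ->
  (forall n, \sum_(0 <= k < n) r k <= C%:E) ->
  limn_esup a <= (b / m)%:E.
Proof.
move=> m0 a0 v0 r0 v0y drift ar rC.
have vy k : v k < +oo.
  elim: k => // k ih; apply: le_lt_trans (lte_add_pinfty ih (ltry b)).
  by apply: le_trans (drift k); rewrite leeDl// mule_ge0// lee_fin ltW.
have vf k : v k = (fine (v k))%:E by rewrite fineK// ge0_fin_numE.
have ay k : a k < +oo.
  rewrite ltey; apply/eqP => ak; have := drift k; rewrite ak gt0_muley ?lte_fin//.
  by rewrite [v k]vf addey ?leye_eq// vf.
have af k : a k = (fine (a k))%:E by rewrite fineK// ge0_fin_numE.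
have ry k : r k < +oo.
  apply: le_lt_trans (ltry C); apply: le_trans (rC k.+1).
  by rewrite big_nat_recr//= leeDr// sume_ge0.
have rf k : r k = (fine (r k))%:E by rewrite fineK// ge0_fin_numE.
have main e : (0 < e)%R ->
    exists N, forall n, (N <= n)%N -> (fine (a n) <= b / m + e)%R.
  apply: (@eventually_le_of_drift _ _ (fine \o v) (fine \o r) m b C) => //=.
  - by move=> k; rewrite fine_ge0.
  - by move=> k; rewrite fine_ge0.
  - by move=> k; rewrite -lee_fin !EFinD EFinM -!vf -af.
  - by move=> k; rewrite -lee_fin !EFinD -!af -rf.
  - move=> n; rewrite -lee_fin -sumEFin; apply: le_trans (rC n).
    by apply: lee_sum => k _; rewrite -rf.
apply/lee_addgt0Pr => e e0; have [N hN] := main e e0.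
by apply: (limn_esup_le_near (N := N)) => n Nn; rewrite af -EFinD lee_fin hN.
Qed.

End Ereal.

(** * Weighted sums and Markov kernels *)

Section WeightedSums.
Local Open Scope ereal_scope.
Context {R : realType} {X : choiceType}.
Implicit Types (S : set X) (phi psi : X -> \bar R) (p : X -> R).

Lemma esum_ge_term S phi x :
  (forall y, S y -> 0 <= phi y) -> S x -> phi x <= \esum_(y in S) phi y.
Proof.
move=> phi0 Sx; apply: esum_ge; exists [set x]; last by rewrite fsbig_set1.
by split; [exact: finite_set1|move=> y ->].
Qed.

Lemma esum_gt0_term S phi : 0 < \esum_(y in S) phi y -> exists2 y, S y & 0 < phi y.
Proof.
move=> h; apply: contrapT => nex; move: h; rewrite ltNge => /negP; apply.
apply: ge_ereal_sup => _ [A [finA AS] <-].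
rewrite fsbig_finite//= big_seq; apply: sume_le0 => y.
rewrite in_fset_set// inE => Ay; rewrite leNgt; apply/negP => py.
by apply: nex; exists y => //; exact: AS.
Qed.

Lemma esumZl S phi (c : R) : (0 <= c)%R -> (forall y, S y -> 0 <= phi y) ->
  \esum_(y in S) (c%:E * phi y) = c%:E * \esum_(y in S) phi y.
Proof.
(* Finite partial sums give one inequality for every factor; the reverse one is the same inequality
   with the factor [c^-1]. *)
have half d psi : (0 <= d)%R -> (forall y, S y -> 0 <= psi y) ->
    \esum_(y in S) (d%:E * psi y) <= d%:E * \esum_(y in S) psi y.
  move=> d0 psi0; apply: ge_ereal_sup => _ [A [finA AS] <-].
  rewrite fsbig_finite//= big_seq -ge0_sume_distrr; last first.
    by move=> y; rewrite in_fset_set// inE => /AS/psi0.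
  rewrite -big_seq lee_wpmul2l ?lee_fin//; apply: ereal_sup_ubound; exists A => //.
  by rewrite fsbig_finite.
move=> c0 phi0; apply/eqP; rewrite eq_le half//=.
have [->|cn0] := eqVneq c 0%R.
  by rewrite mul0e esum_ge0// => y _; rewrite mul0e.
have {cn0} c_gt0 : (0 < c)%R by rewrite lt_def cn0.
rewrite -(@lee_pmul2l _ c^-1%:E)// ?lte_fin ?invr_gt0//.
rewrite muleA -EFinM mulVf ?gt_eqF// mul1e.
apply: le_trans (half _ _ _ _); last 2 first.
  by rewrite invr_ge0.
  by move=> y Sy; rewrite mule_ge0 ?phi0.
by apply: le_esum => y _; rewrite muleA -EFinM mulVf ?gt_eqF// mul1e.
Qed.

Definition wsum S p phi : \bar R := \esum_(y in S) ((p y)%:E * phi y).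

Variables (S : set X) (p : X -> R).
Hypothesis p0 : forall y, S y -> (0 <= p y)%R.

Lemma wsum_ge0 phi : (forall y, S y -> 0 <= phi y) -> 0 <= wsum S p phi.
Proof. by move=> h; apply: esum_ge0 => y Sy; rewrite mule_ge0 ?h// lee_fin p0. Qed.

Lemma le_wsum phi psi : (forall y, S y -> phi y <= psi y) ->
  wsum S p phi <= wsum S p psi.
Proof. by move=> h; apply: le_esum => y Sy; rewrite lee_wpmul2l ?h// lee_fin p0. Qed.

Lemma eq_wsum phi psi : (forall y, S y -> phi y = psi y) ->
  wsum S p phi = wsum S p psi.
Proof. by move=> h; apply: eq_esum => y Sy; rewrite h. Qed.

Lemma wsumD phi psi :
  (forall y, S y -> 0 <= phi y) -> (forall y, S y -> 0 <= psi y) ->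
  wsum S p (fun y => phi y + psi y) = wsum S p phi + wsum S p psi.
Proof.
move=> phi0 psi0; rewrite /wsum -esumD.
- by apply: eq_esum => y Sy; rewrite ge0_muleDr ?phi0 ?psi0.
- by move=> y Sy; rewrite mule_ge0 ?phi0// lee_fin p0.
- by move=> y Sy; rewrite mule_ge0 ?psi0// lee_fin p0.
Qed.

Lemma wsumZ c phi : (0 <= c)%R -> (forall y, S y -> 0 <= phi y) ->
  wsum S p (fun y => c%:E * phi y) = c%:E * wsum S p phi.
Proof.
move=> c0 phi0; rewrite /wsum -esumZl//.
  by apply: eq_esum => y Sy; rewrite muleCA.
by move=> y Sy; rewrite mule_ge0 ?phi0// lee_fin p0.
Qed.

Lemma wsum_sum (I : choiceType) (s : seq I) (F : I -> X -> \bar R) :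
  (forall i y, S y -> 0 <= F i y) ->
  wsum S p (fun y => \sum_(i <- s) F i y) = \sum_(i <- s) wsum S p (F i).
Proof.
move=> F0; elim: s => [|i s ih].
  rewrite big_nil; apply: esum1 => y _; by rewrite big_nil mule0.
rewrite big_cons -ih -wsumD => [|y /F0|y Sy]; [|exact|]; last first.
  by apply: sume_ge0 => j _; exact: F0.
by apply: eq_wsum => y _; rewrite big_cons.
Qed.

Lemma wsum_gt0 phi y : (forall y, S y -> 0 <= phi y) -> S y ->
  (0 < p y)%R -> 0 < phi y -> 0 < wsum S p phi.
Proof.
move=> phi0 Sy py phiy; apply: (@lt_le_trans _ _ ((p y)%:E * phi y)).
  by rewrite mule_gt0.
apply: (@esum_ge_term S (fun y => (p y)%:E * phi y)) => // z Sz.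
by rewrite mule_ge0 ?phi0// lee_fin p0.
Qed.

Hypothesis p1 : \esum_(y in S) (p y)%:E = 1.

Lemma wsum_cst c : (0 <= c)%R -> wsum S p (fun=> c%:E) = c%:E.
Proof.
move=> c0; have -> : wsum S p (fun=> c%:E) = \esum_(y in S) (c%:E * (p y)%:E).
  by apply: eq_esum => y _; rewrite muleC.
by rewrite esumZl// ?p1 ?mule1.
Qed.

Lemma wsum_ge c phi : 0 <= c -> (forall y, S y -> c <= phi y) -> c <= wsum S p phi.
Proof.
case: c => [c| |] c0 h //.
  by rewrite -[leLHS](@wsum_cst c)//; exact: le_wsum.
rewrite leye_eq; apply/eqP/eq_infty => t; apply: (@le_trans _ _ (Num.max t 0)%:E).
  by rewrite lee_fin le_max lexx.
rewrite -[leLHS]wsum_cst ?le_max ?lexx ?orbT//; apply: le_wsum => y /h.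
by rewrite leye_eq => /eqP->; rewrite leey.
Qed.

Lemma wsum_le (c : R) phi : (0 <= c)%R -> (forall y, S y -> phi y <= c%:E) ->
  wsum S p phi <= c%:E.
Proof. by move=> c0 h; rewrite -[leRHS]wsum_cst//; exact: le_wsum. Qed.

End WeightedSums.

(** * Transition operators of one chain and of two independent copies *)

Section Kernel.
Local Open Scope ereal_scope.
Context {R : realType} {X : choiceType}.
Variables (S : set X) (K : X -> X -> R).
Hypothesis hK : transition_matrix S K.
Implicit Types (phi psi : X -> \bar R) (Phi Psi : X -> X -> \bar R).

Let K0 x y : S x -> S y -> (0 <= K x y)%R. Proof. by move=> Sx; apply: (hK Sx).1. Qed.
Let K1 x : S x -> \esum_(y in S) (K x y)%:E = 1. Proof. by move=> /hK[]. Qed.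

(** [iter n kop phi x] is the mean of [phi] after [n] steps from [x]. *)
Definition kop phi : X -> \bar R := fun x => wsum S (K x) phi.

Lemma kop_ge0 phi : (forall x, S x -> 0 <= phi x) -> forall x, S x -> 0 <= kop phi x.
Proof. by move=> h x Sx; apply: wsum_ge0 => // y; exact: K0. Qed.

Lemma iter_kop_ge0 n phi : (forall x, S x -> 0 <= phi x) ->
  forall x, S x -> 0 <= iter n kop phi x.
Proof. by move=> h; elim: n => //= n ih; exact: kop_ge0. Qed.

Lemma le_iter_kop n phi psi : (forall x, S x -> phi x <= psi x) ->
  forall x, S x -> iter n kop phi x <= iter n kop psi x.
Proof.
move=> h; elim: n => //= n ih x Sx.
by apply: le_wsum => // y; exact: K0.
Qed.

Lemma iter_kopD n phi psi : (forall x, S x -> 0 <= phi x) ->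
  (forall x, S x -> 0 <= psi x) -> forall x, S x ->
  iter n kop (fun y => phi y + psi y) x = iter n kop phi x + iter n kop psi x.
Proof.
move=> h1 h2; elim: n => //= n ih x Sx; rewrite /kop -wsumD.
- by apply: eq_wsum => y Sy; rewrite ih.
- by move=> y; exact: K0.
- exact: iter_kop_ge0.
- exact: iter_kop_ge0.
Qed.

Lemma iter_kopZ n (c : R) phi : (0 <= c)%R -> (forall x, S x -> 0 <= phi x) ->
  forall x, S x -> iter n kop (fun y => c%:E * phi y) x = c%:E * iter n kop phi x.
Proof.
move=> c0 h1; elim: n => //= n ih x Sx; rewrite /kop -wsumZ//.
- by apply: eq_wsum => y Sy; rewrite ih.
- by move=> y; exact: K0.
- exact: iter_kop_ge0.
Qed.

Lemma iter_kop_cst n (c : R) : (0 <= c)%R ->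
  forall x, S x -> iter n kop (fun=> c%:E) x = c%:E.
Proof.
move=> c0; elim: n => //= n ih x Sx; rewrite /kop (@eq_wsum _ _ _ _ _ (fun=> c%:E))//.
by rewrite wsum_cst ?K1// => y; exact: K0.
Qed.

(* Two independent copies of the chain, killed when they meet. *)
Definition pair_op Phi : X -> X -> \bar R := fun x x' =>
  if x == x' then 0 else kop (fun y => kop (Phi y) x') x.

(** With this initial function, [iter n pair_op] yields the mean of [Phi] at time [n] on the event
    of no meeting up to and including time [n]. *)
Definition off_diag Phi : X -> X -> \bar R := fun x x' => if x == x' then 0 else Phi x x'.

Definition pair_ge0 Phi := forall x x', S x -> S x' -> 0 <= Phi x x'.

Lemma pair_op_ge0 Phi : pair_ge0 Phi -> pair_ge0 (pair_op Phi).
Proof.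
move=> h x x' Sx Sx'; rewrite /pair_op; case: ifP => // _.
by apply: kop_ge0 => // y Sy; apply: kop_ge0 => // z Sz; exact: h.
Qed.

Lemma off_diag_ge0 Phi : pair_ge0 Phi -> pair_ge0 (off_diag Phi).
Proof. by move=> h x x' Sx Sx'; rewrite /off_diag; case: ifP => // _; exact: h. Qed.

Lemma iter_pair_op_ge0 n Phi : pair_ge0 Phi -> pair_ge0 (iter n pair_op Phi).
Proof. by move=> h; elim: n => //= n; exact: pair_op_ge0. Qed.

Lemma le_pair_op Phi Psi : (forall x x', S x -> S x' -> Phi x x' <= Psi x x') ->
  forall x x', S x -> S x' -> pair_op Phi x x' <= pair_op Psi x x'.
Proof.
move=> h x x' Sx Sx'; rewrite /pair_op; case: ifP => // _.
apply: le_wsum => [y|y Sy]; first exact: K0.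
by apply: le_wsum => [z|z Sz]; [exact: K0|exact: h].
Qed.

Lemma pair_opD Phi Psi : pair_ge0 Phi -> pair_ge0 Psi ->
  forall x x', S x -> S x' ->
  pair_op (fun y y' => Phi y y' + Psi y y') x x' = pair_op Phi x x' + pair_op Psi x x'.
Proof.
move=> h1 h2 x x' Sx Sx'; rewrite /pair_op; case: ifP => [|_]; first by rewrite adde0.
rewrite /kop -wsumD; last 3 first.
- by move=> y; exact: K0.
- by move=> y Sy; apply: kop_ge0 => // z Sz; exact: h1.
- by move=> y Sy; apply: kop_ge0 => // z Sz; exact: h2.
apply: eq_wsum => y Sy; rewrite wsumD//.
- by move=> z; exact: K0.
- by move=> z; exact: h1.
- by move=> z; exact: h2.
Qed.

Lemma pair_opZ (c : R) Phi : (0 <= c)%R -> pair_ge0 Phi -> forall x x', S x -> S x' ->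
  pair_op (fun y y' => c%:E * Phi y y') x x' = c%:E * pair_op Phi x x'.
Proof.
move=> c0 h1 x x' Sx Sx'; rewrite /pair_op; case: ifP => [|_]; first by rewrite mule0.
rewrite /kop -wsumZ//; last 2 first.
- by move=> y; exact: K0.
- by move=> y Sy; apply: kop_ge0 => // z Sz; exact: h1.
apply: eq_wsum => y Sy; rewrite wsumZ//.
- by move=> z; exact: K0.
- by move=> z; exact: h1.
Qed.

Lemma pair_op_sum N (F : nat -> X -> X -> \bar R) : (forall n, pair_ge0 (F n)) ->
  forall x x', S x -> S x' ->
  pair_op (fun y y' => \sum_(0 <= n < N) F n y y') x x' =
  \sum_(0 <= n < N) pair_op (F n) x x'.
Proof.
move=> F0 x x' Sx Sx'; rewrite /pair_op; case: ifP => [|_]; first by rewrite big1.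
rewrite /kop -wsum_sum; last 2 first.
- by move=> y; exact: K0.
- by move=> n y Sy; apply: kop_ge0 => // z Sz; exact: F0.
apply: eq_wsum => y Sy; rewrite wsum_sum//.
- by move=> z; exact: K0.
- by move=> n z; exact: F0.
Qed.

(** Supersolution principle: the first term of the sum is [F], and the others are [pair_op] of a
    shorter sum, which is at most [H] by induction. On the diagonal every term vanishes. *)
Lemma sum_iter_pair_op_le F H : pair_ge0 F -> pair_ge0 H ->
  (forall x x', S x -> S x' -> x != x' -> F x x' + pair_op H x x' <= H x x') ->
  forall N x x', S x -> S x' ->
  \sum_(0 <= n < N) iter n pair_op (off_diag F) x x' <= H x x'.
Proof.
move=> F0 H0 super; have oF0 := off_diag_ge0 F0.
elim=> [|N ih] x x' Sx Sx'; first by rewrite big_nil H0.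
rewrite big_nat_recl//=; have [xx'|xx'] := eqVneq x x'.
  rewrite big1 => [|n _]; first by rewrite /off_diag xx' eqxx adde0 H0 -?xx'.
  by rewrite /pair_op xx' eqxx.
apply: le_trans (super x x' Sx Sx' xx'); rewrite /off_diag (negbTE xx') leeD//.
rewrite -(@pair_op_sum N (fun n => iter n pair_op (off_diag F)))//; last first.
  by move=> n; exact: iter_pair_op_ge0.
exact: le_pair_op.
Qed.

(** Copies at the same state have the same future law, so only pairs that have not met contribute to
    the difference. The induction takes the first step of both copies and compares from their new
    positions. *)
Lemma iter_kop_le_coupling phi : (forall x, S x -> 0 <= phi x) ->
  forall n x x', S x -> S x' ->
  iter n kop phi x <=
    iter n kop phi x' + iter n pair_op (off_diag (fun y y' => phi y + phi y')) x x'.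
Proof.
move=> phi0; set F := off_diag _.
have F0 : pair_ge0 F by apply: off_diag_ge0 => x x' Sx Sx'; rewrite adde_ge0 ?phi0.
elim=> [|n ih] x x' Sx Sx' /=.
  rewrite /F /off_diag; have [->|xx'] := eqVneq x x'; first by rewrite adde0.
  by rewrite addeC -addeA leeDl// adde_ge0 ?phi0.
rewrite /pair_op; have [->|xx'] := eqVneq x x'; first by rewrite adde0.
set u := iter n kop phi; set Q := iter n pair_op F.
have u0 : forall y, S y -> 0 <= u y by exact: iter_kop_ge0.
have Q0 : pair_ge0 Q by exact: iter_pair_op_ge0.
apply: (@le_trans _ _ (kop (fun y => kop u x' + kop (Q y) x') x)).
  apply: le_wsum => [y|y Sy]; first exact: K0.
  rewrite /kop -wsumD//; last 2 first.
  - by move=> z; exact: K0.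
  - by move=> z; exact: Q0.
  apply: wsum_ge => [z||| z Sz]; [exact: K0|exact: K1|exact: u0|exact: ih].
have ux'0 : 0 <= kop u x' by exact: kop_ge0.
rewrite /kop wsumD//; last 2 first.
- by move=> y; exact: K0.
- by move=> y Sy; apply: kop_ge0 => // z Sz; exact: Q0.
rewrite leeD2r// -/(kop u x').
(* The mean of a constant is computed for a finite constant; an infinite value makes the inequality
   trivial. *)
case: (kop u x') ux'0 => [c c0|_|//]; last by rewrite leey.
by rewrite wsum_cst ?K1// => y; exact: K0.
Qed.

Definition not_met n := iter n pair_op (off_diag (fun _ _ => 1)).

Lemma not_met_ge0 n : pair_ge0 (not_met n).
Proof. by apply: iter_pair_op_ge0; exact: off_diag_ge0. Qed.

Lemma not_met_le1 n x x' : S x -> S x' -> not_met n x x' <= 1.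
Proof.
elim: n x x' => [|n ih] x x' Sx Sx'; rewrite /not_met /=.
  by rewrite /off_diag; case: ifP.
rewrite /pair_op; case: ifP => // _.
apply: wsum_le => //; [by move=> y; exact: K0|exact: K1|move=> y Sy].
by apply: wsum_le => //; [by move=> z; exact: K0|exact: K1|move=> z Sz; exact: ih].
Qed.

(** The complement [1 - phi] has positive mean because [y] carries positive weight, and the two
    means add up to 1. *)
Lemma wsum_lt1 x y phi : S x -> S y -> (forall z, S z -> 0 <= phi z <= 1) ->
  (0 < K x y)%R -> phi y < 1 -> wsum S (K x) phi < 1.
Proof.
move=> Sx Sy phi01 Kxy phiy.
have K0x := fun z => @K0 x z Sx.
have fphi z : S z -> phi z = (fine (phi z))%:E.
  move=> /phi01/andP[h1 h2]; rewrite fineK// ge0_fin_numE//.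
  by rewrite (le_lt_trans h2)// ltry.
have c0 z : S z -> 0 <= (1 - fine (phi z))%:E.
  by move=> Sz; rewrite lee_fin subr_ge0 -lee_fin -fphi//; case/andP: (phi01 _ Sz).
have tot : wsum S (K x) phi + wsum S (K x) (fun z => (1 - fine (phi z))%:E) = 1.
  rewrite -wsumD//; last by move=> z /phi01/andP[].
  rewrite (@eq_wsum _ _ _ _ _ (fun=> 1)) ?wsum_cst ?K1//.
  by move=> z Sz; rewrite [phi z]fphi// -EFinD addrC subrK.
have pos : 0 < wsum S (K x) (fun z => (1 - fine (phi z))%:E).
  by apply: (@wsum_gt0 _ _ _ _ _ _ y) => //; rewrite lte_fin subr_gt0 -lte_fin -fphi.
have w0 : 0 <= wsum S (K x) phi by apply: wsum_ge0 => // z /phi01/andP[].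
rewrite ltNge; apply/negP => w1; move: tot; apply/eqP; rewrite gt_eqF//.
apply: (@lt_le_trans _ _ (1 + wsum S (K x) (fun z => (1 - fine (phi z))%:E))).
  by rewrite lteDl.
by rewrite leeD2r.
Qed.

Lemma kstep_ge0 n x y : S x -> 0 <= kstep S K n x y.
Proof.
elim: n x => [|n ih] x Sx /=; first by rewrite lee_fin ler0n.
by apply: wsum_ge0 => [z|z]; [exact: K0|exact: ih].
Qed.

Lemma kstepS_gt0 n x y : S x -> 0 < kstep S K n.+1 x y ->
  exists z, [/\ S z, (0 < K x z)%R & 0 < kstep S K n z y].
Proof.
move=> Sx /= /esum_gt0_term[z Sz h]; exists z; split => //.
  rewrite lt_neqAle K0// andbT; apply/eqP => Kxz.
  by move: h; rewrite -Kxz mul0e ltxx.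
rewrite lt_neqAle kstep_ge0// andbT; apply/eqP => kz.
by move: h; rewrite -kz mule0 ltxx.
Qed.

Lemma kstep_gt0_trans m n x y z : S x -> S y ->
  0 < kstep S K m x y -> 0 < kstep S K n y z -> 0 < kstep S K (m + n) x z.
Proof.
move=> + Sy; elim: m x => [|m ih] x Sx.
  by rewrite /=; have [->|] := eqVneq x y; rewrite ?add0n ?ltxx.
move=> /(kstepS_gt0 Sx)[w [Sw Kxw kw]] kn; rewrite addSn /=.
apply: (@wsum_gt0 _ _ _ _ _ _ w) => //; last exact: ih.
  by move=> t; exact: K0.
by move=> t; exact: kstep_ge0.
Qed.

(** Independent copies follow their two paths to [y] simultaneously with positive probability, so
    they meet at time [n] unless they did so earlier. *)
Lemma not_met_lt1 n x x' y : S x -> S x' ->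
  0 < kstep S K n x y -> 0 < kstep S K n x' y -> not_met n x x' < 1.
Proof.
elim: n x x' => [|n ih] x x' Sx Sx'.
  rewrite /=; have [->|] := eqVneq x y; last by rewrite ltxx.
  have [-> _ _|] := eqVneq x' y; last by rewrite ltxx.
  by rewrite /not_met /= /off_diag eqxx lte01.
move=> /(kstepS_gt0 Sx)[z [Sz Kz kz]] /(kstepS_gt0 Sx')[z' [Sz' Kz' kz']].
rewrite /not_met /= /pair_op; case: ifP => // _.
have n01 y1 y2 : S y1 -> S y2 -> 0 <= not_met n y1 y2 <= 1.
  by move=> S1 S2; rewrite not_met_ge0// not_met_le1.
apply: (@wsum_lt1 _ z) => //.
- move=> t St; apply/andP; split.
    by apply: wsum_ge0 => [?|? ?]; [exact: K0|exact: not_met_ge0].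
  apply: wsum_le => //; [by move=> z1; exact: K0|exact: K1|].
  by move=> z2 Sz2; exact: not_met_le1.
- apply: (@wsum_lt1 _ z') => //; first by move=> t St; exact: n01.
  exact: ih.
Qed.

End Kernel.

(** * Foster-Lyapunov bound on the limsup *)

(** The least positive difference [d] between two elements divides every element, hence is 1; two
    consecutive elements then generate all large integers. *)
Lemma semigroup_cofinite (A : set nat) : A 0%N ->
  (forall m n, A m -> A n -> A (m + n)%N) ->
  (forall d, (forall n, (0 < n)%N -> A n -> (d %| n)%N) -> d = 1%N) ->
  exists N, forall n, (N <= n)%N -> A n.
Proof.
move=> A0 AD gcd1.
have AM k n : A n -> A (k * n)%N.
  by move=> An; elim: k => [|k ih]; rewrite ?mul0n// mulSn; exact: AD.
pose D d := `[< (0 < d)%N /\ exists2 b, A b & A (b + d)%N >].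
have exD : exists d, D d.
  (* A positive element would differ from [0]; without any, the divisibility hypothesis would hold
     vacuously for 2. *)
  apply: contrapT => nD; suff : 2%N = 1%N by [].
  apply: gcd1 => n n0 An; exfalso; apply: nD; exists n; apply/asboolP.
  by split => //; exists 0%N.
case: (ex_minnP exD) => d /asboolP[d0 [b Ab Abd]] dmin.
have d1 : d = 1%N.
  (* A nonzero remainder of [n] by [d] would be a smaller difference, namely between
     [n %/ d * (b + d)] and [n + n %/ d * b]. *)
  apply: gcd1 => n _ An; rewrite /dvdn -leqn0 leqNgt; apply/negP => r0.
  have : D (n %% d)%N.
    apply/asboolP; split => //; exists (n %/ d * (b + d))%N; first exact: AM.
    have -> : (n %/ d * (b + d) + n %% d = n + n %/ d * b)%N.
      by rewrite mulnDr -addnA -divn_eq addnC.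
    by apply: AD => //; exact: AM.
  by move/dmin; rewrite leqNgt ltn_mod d0.
move: Abd; rewrite d1 addn1 => Ab1.
(* The consecutive elements [b] and [b.+1] generate every [n >= b * b]. *)
exists (b * b)%N => n bn; have [b0|b0] := posnP b.
  by rewrite -[n]muln1; apply: AM; rewrite b0 in Ab1.
have rq : (n %% b <= n %/ b)%N.
  by apply: (@leq_trans b); [rewrite ltnW// ltn_mod|rewrite leq_divRL].
have -> : n = ((n %/ b - n %% b) * b + (n %% b) * b.+1)%N.
  by rewrite mulnS addnCA -mulnDl subnK// addnC -divn_eq.
by apply: AD; exact: AM.
Qed.

Section Foster.
Local Open Scope ereal_scope.
Context {R : realType} {X : choiceType}.
Variables (S : set X) (K : X -> X -> R).
Hypothesis hK : transition_matrix S K.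

(** Irreducibility of one chain does not make the product chain irreducible. Aperiodicity allows a
    return to [x] after any large number of steps, so both copies can be at [x] at a common time. *)
Lemma pairs_meet x x' : irreducible_chain S K -> aperiodic_chain S K ->
  S x -> S x' -> exists n, not_met S K n x x' < 1.
Proof.
move=> irr aper Sx Sx'; have [a xa] := irr x x Sx Sx; have [a' xa'] := irr x' x Sx' Sx.
have [|||N hN] := @semigroup_cofinite [set n | 0 < kstep S K n x x].
- by rewrite /= eqxx lte01.
- by move=> m n; exact: kstep_gt0_trans.
- by move=> d hd; apply: (aper x Sx); exact: hd.
exists (a' + (a + N))%N; apply: (@not_met_lt1 _ _ _ _ hK _ _ _ x) => //.
  by apply: hN; rewrite addnA leq_addl.
by apply: (@kstep_gt0_trans _ _ _ _ hK _ _ _ x) => //; apply: hN; rewrite leq_addl.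
Qed.

(** [h] bounds the expected number of visits to [l] before the meeting, uniformly in the starting
    pair. Potentials of single pairs add up, and a pair with meeting probability [de] within [M]
    steps costs at most [M / de]. *)
Lemma bounded_pair_potential (l : seq (X * X)) :
  irreducible_chain S K -> aperiodic_chain S K ->
  (forall z, z \in l -> S z.1 /\ S z.2) ->
  exists (h : X -> X -> \bar R) (B : R), [/\ (0 <= B)%R,
    (forall x x', S x -> S x' -> 0 <= h x x' <= B%:E) &
    forall x x', S x -> S x' -> x != x' ->
      ((x, x') \in l)%:R%:E + pair_op S K h x x' <= h x x'].
Proof.
move=> irr aper; elim: l => [|[z z'] l ih] hl.
  exists (fun _ _ => 0), 0%R; split => //; first by move=> *; rewrite lexx.
  move=> x x' Sx Sx' _; rewrite in_nil add0e.
  rewrite /pair_op; case: ifP => // _.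
  rewrite /kop /wsum esum1// => y _; rewrite esum1 ?mule0// => t _.
  by rewrite mule0.
have [h [B [B0 h01 hsup]]] := ih (fun t tl => hl t (mem_behead (s := _ :: _) tl)).
have [/= Sz Sz'] := hl (z, z') (mem_head _ _).
have [M gM] := pairs_meet irr aper Sz Sz'.
have g0 n := not_met_ge0 hK n; have g1 n := not_met_le1 hK n.
pose g n x x' := fine (not_met S K n x x').
have gE n x x' : S x -> S x' -> not_met S K n x x' = (g n x x')%:E.
  move=> Sx Sx'; rewrite fineK// ge0_fin_numE ?g0//.
  by rewrite (le_lt_trans (g1 _ _ _ Sx Sx'))// ltry.
pose de := (1 - g M z z')%R.
have de0 : (0 < de)%R by rewrite subr_gt0 -lte_fin -gE.
(* The sum telescopes under [pair_op]: off the diagonal [G] drops by the probability of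
   having met by time [M], which is at least [de] from [(z, z')]. *)
pose G x x' := \sum_(0 <= n < M) not_met S K n x x'.
have G0 : pair_ge0 S G by move=> x x' Sx Sx'; apply: sume_ge0 => n _; exact: g0.
have Gle x x' : S x -> S x' -> G x x' <= M%:R%:E.
  move=> Sx Sx'; apply: (@le_trans _ _ (\sum_(0 <= n < M) 1)).
    by apply: lee_sum => n _; exact: g1.
  by rewrite sumEFin lee_fin sumr_const_nat subn0.
have GfE x x' : S x -> S x' -> G x x' = (fine (G x x'))%:E.
  move=> Sx Sx'; rewrite fineK// ge0_fin_numE ?G0//.
  by rewrite (le_lt_trans (Gle _ _ Sx Sx'))// ltry.
have Gtel x x' : S x -> S x' -> x != x' ->
    pair_op S K G x x' = G x x' + (g M x x' - 1)%:E.
  move=> Sx Sx' xx'; rewrite (pair_op_sum hK)//.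
  have -> : \sum_(0 <= n < M) pair_op S K (not_met S K n) x x' =
            (\sum_(0 <= n < M) g n.+1 x x')%:E.
    by rewrite -sumEFin; apply: eq_bigr => n _; rewrite -gE.
  have -> : G x x' = (\sum_(0 <= n < M) g n x x')%:E.
    by rewrite -sumEFin; apply: eq_bigr => n _; rewrite -gE.
  rewrite -EFinD; congr EFin.
  have g01 : g 0%N x x' = 1%R by rewrite /g /not_met /= /off_diag (negbTE xx').
  have e1 : (\sum_(0 <= n < M.+1) g n x x' = \sum_(0 <= n < M) g n x x' + g M x x')%R.
    by rewrite big_nat_recr.
  have e2 : (\sum_(0 <= n < M.+1) g n x x' = 1 + \sum_(0 <= n < M) g n.+1 x x')%R.
    by rewrite big_nat_recl// g01.
  by lra.
exists (fun x x' => h x x' + de^-1%:E * G x x'), (B + de^-1 * M%:R)%R.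
have dV0 : (0 <= de^-1)%R by rewrite invr_ge0 ltW.
have h0 : pair_ge0 S h by move=> x x' Sx Sx'; case/andP: (h01 _ _ Sx Sx').
have dG0 : pair_ge0 S (fun x x' => de^-1%:E * G x x').
  by move=> x x' Sx Sx'; rewrite mule_ge0// G0.
split.
- by rewrite addr_ge0// mulr_ge0.
- move=> x x' Sx Sx'; case/andP: (h01 _ _ Sx Sx') => hx hB.
  rewrite adde_ge0 ?dG0//= EFinD leeD// EFinM lee_wpmul2l//.
  exact: Gle.
- move=> x x' Sx Sx' xx'; rewrite pair_opD// pair_opZ// Gtel//.
  have ind : (((x, x') \in (z, z') :: l)%:R <= ((x, x') \in l)%:R + ((x, x') == (z, z'))%:R :> R)%R.
    rewrite in_cons; case: (_ == _); case: (_ \in _) => /=; lra.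
  have key : (((x, x') == (z, z'))%:R <= de^-1 * (1 - g M x x'))%R.
    case: eqP => [[-> ->]|_]; first by rewrite -/de mulVf ?gt_eqF.
    by rewrite mulr_ge0// subr_ge0 -lee_fin -gE// g1.
  have -> : de^-1%:E * (G x x' + (g M x x' - 1)%:E) =
     de^-1%:E * G x x' - (de^-1 * (1 - g M x x'))%:E.
    by rewrite GfE// -!EFinM -EFinN -!EFinD; congr EFin; ring.
  apply: (@le_trans _ _ (((x, x') \in l)%:R%:E + pair_op S K h x x' + de^-1%:E * G x x')).
    have p0 : 0 <= pair_op S K h x x' by exact: pair_op_ge0.
    have pf : pair_op S K h x x' = (fine (pair_op S K h x x'))%:E.
      rewrite fineK// ge0_fin_numE//; have := hsup x x' Sx Sx' xx'.
      case/andP: (h01 _ _ Sx Sx') => _ hB /le_trans/(_ hB) hh.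
      apply: le_lt_trans (ltry B); apply: le_trans hh.
      by rewrite leeDr// lee_fin.
    rewrite pf GfE// -!EFinM -EFinN -!EFinD lee_fin; lra.
  by rewrite leeD2r// hsup.
Qed.

Theorem limn_esup_foster (lam V f : X -> R) (m b : R) :
  irreducible_chain S K -> aperiodic_chain S K ->
  (forall x, S x -> 0 <= lam x)%R -> \esum_(x in S) (lam x)%:E = 1 ->
  (forall x, S x -> 0 <= V x)%R -> (forall x, S x -> 0 <= f x)%R ->
  (0 < m)%R -> (0 <= b)%R ->
  (forall x, S x -> kop S K (EFin \o V) x + (m * f x)%:E <= (V x + b)%:E) ->
  (forall c, finite_set [set x | S x /\ (f x <= c)%R]) ->
  wsum S lam (EFin \o V) < +oo ->
  limn_esup (fun k => wsum S lam (iter k (kop S K) (EFin \o f))) <= (b / m)%:E.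
Proof.
move=> irr aper lam0 lam1 V0 f0 m0 b0 drift fin lamV.
have EV0 x : S x -> 0 <= (EFin \o V) x by move=> Sx; rewrite lee_fin V0.
have Ef0 x : S x -> 0 <= (EFin \o f) x by move=> Sx; rewrite lee_fin f0.
have kV x : S x -> kop S K (EFin \o V) x <= (V x + b)%:E.
  by move=> Sx; apply: le_trans (drift x Sx); rewrite leeDl// lee_fin mulr_ge0 ?f0// ltW.
pose c0 := (4 * b / m)%R.
have c0_ge0 : (0 <= c0)%R by rewrite divr_ge0 ?mulr_ge0// ltW.
pose C := [set x | S x /\ (f x <= c0)%R].
pose lC := [seq (x, y) | x <- finmap.enum_fset (fset_set C), y <- finmap.enum_fset (fset_set C)].
have inC x x' : ((x, x') \in lC) = (x \in C) && (x' \in C).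
  rewrite -[x \in C]in_fset_set; last exact: fin.
  rewrite -[x' \in C]in_fset_set; last exact: fin.
  by apply/allpairsP/andP => [[[y y'] /= [h1 h2 [-> ->]]]//|[h1 h2]]; exists (x, x').
have [|h [B [B0 h01 hsup]]] := @bounded_pair_potential lC irr aper.
  by move=> [x x']; rewrite inC => /andP[]; rewrite !inE => -[? _] [].
have h0 : pair_ge0 S h by move=> x x' Sx Sx'; case/andP: (h01 _ _ Sx Sx').
pose F := fun x x' : X => (EFin \o f) x + (EFin \o f) x'.
pose W := fun x x' : X => (EFin \o V) x + (EFin \o V) x'.
have F0 : pair_ge0 S F by move=> x x' Sx Sx'; rewrite adde_ge0// ?Ef0.
have W0 : pair_ge0 S W by move=> x x' Sx Sx'; rewrite adde_ge0// ?EV0.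
have al0 : (0 <= 2 / m)%R by rewrite divr_ge0// ltW.
pose H := fun x x' => (2 / m)%:E * W x x' + c0%:E * h x x'.
have aW0 : pair_ge0 S (fun x x' => (2 / m)%:E * W x x').
  by move=> x x' Sx Sx'; rewrite mule_ge0// W0.
have ch0 : pair_ge0 S (fun x x' => c0%:E * h x x').
  by move=> x x' Sx Sx'; rewrite mule_ge0// h0.
have H0 : pair_ge0 S H by move=> x x' Sx Sx'; rewrite adde_ge0 ?aW0 ?ch0.
(* [W] is a sum of functions of one state each, so the product kernel acts on it through its two
   marginals. *)
have opW x x' : S x -> S x' -> x != x' ->
    pair_op S K W x x' + (m * (f x + f x'))%:E <= (V x + V x' + 2 * b)%:E.
  move=> Sx Sx' xx'; rewrite /pair_op (negbTE xx').
  have -> : kop S K (fun y => kop S K (W y) x') x =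
      kop S K (EFin \o V) x + kop S K (EFin \o V) x'.
    rewrite /kop.
    have e y : S y -> wsum S (K x') (W y) = (V y)%:E + wsum S (K x') (EFin \o V).
      move=> Sy; rewrite wsumD//; last 2 first.
      - exact: (hK Sx').1.
      - by move=> z _; rewrite lee_fin V0.
      by rewrite wsum_cst ?V0//; [exact: (hK Sx').1|exact: (hK Sx').2].
    rewrite (@eq_wsum _ _ _ _ _ _ e).
    have kx' := kV _ Sx'; have kx'0 := kop_ge0 hK EV0 Sx'.
    rewrite wsumD//; last first.
    - exact: (hK Sx).1.
    rewrite -[wsum S (K x') _]fineK; last first.
      by rewrite ge0_fin_numE// (le_lt_trans kx')// ltry.
    rewrite wsum_cst ?fine_ge0//; [exact: (hK Sx).1|exact: (hK Sx).2].
  have := leeD (drift x Sx) (drift x' Sx').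
  rewrite -EFinD mulrDr EFinD addeACA => /le_trans; apply.
  by rewrite lee_fin; lra.
have super x x' : S x -> S x' -> x != x' -> F x x' + pair_op S K H x x' <= H x x'.
  move=> Sx Sx' xx'; have := opW x x' Sx Sx' xx'; have := hsup x x' Sx Sx' xx'.
  rewrite /H (pair_opD hK aW0 ch0)// (pair_opZ hK al0 W0)// (pair_opZ hK c0_ge0 h0)// /F /=.
  have p1 := pair_op_ge0 hK W0 Sx Sx'; have p2 := pair_op_ge0 hK h0 Sx Sx'.
  case/andP: (h01 x x' Sx Sx') => hx0 hxB.
  have hf : h x x' = (fine (h x x'))%:E.
    by rewrite fineK// ge0_fin_numE// (le_lt_trans hxB)// ltry.
  move: (h x x') (pair_op S K W x x') (pair_op S K h x x') hf p1 p2 hx0 => t1 t2 t3.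
  case: t1 => [t1| |]// _; case: t2 => [t2| |]//; case: t3 => [t3| |]//.
  rewrite -!EFinM -!EFinD !lee_fin => t2_0 t3_0 t1_0 h1 h2.
  have h3 : (2 / m * (t2 + m * (f x + f x')) <= 2 / m * (V x + V x' + 2 * b))%R.
    by rewrite ler_wpM2l.
  have e1 : (2 / m * (t2 + m * (f x + f x')) = 2 / m * t2 + 2 * (f x + f x'))%R.
    by field; rewrite gt_eqF.
  have e2 : (2 / m * (V x + V x' + 2 * b) = 2 / m * (V x + V x') + c0)%R.
    by rewrite /c0; field; rewrite gt_eqF.
  (* [h3] is the scaled pair drift, [h4] the decrease of [c0 * h], and [h5] says that backlog or
     indicator covers [c0]; their sum is the goal. *)
  rewrite e1 e2 in h3.
  have h4 : (c0 * (((x, x') \in lC)%:R + t3) <= c0 * t1)%R by rewrite ler_wpM2l.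
  rewrite mulrDr in h4.
  have fx := f0 _ Sx; have fx' := f0 _ Sx'.
  have h5 : (c0 <= f x + f x' + c0 * ((x, x') \in lC)%:R)%R.
    have [xlC|] := boolP ((x, x') \in lC); first by rewrite mulr1; lra.
    rewrite inC negb_and mulr0 addr0 => /orP[]; rewrite notin_setE => nC.
      have /ltW : (c0 < f x)%R by rewrite ltNge; apply/negP => ?; apply: nC.
      lra.
    have /ltW : (c0 < f x')%R by rewrite ltNge; apply/negP => ?; apply: nC.
    lra.
  lra.
pose Q := fun n => iter n (pair_op S K) (off_diag F).
have Q0 n : pair_ge0 S (Q n) by apply: iter_pair_op_ge0 => //; exact: off_diag_ge0.
have sumQ := sum_iter_pair_op_le hK F0 H0 super.
pose u n := iter n (kop S K) (EFin \o f).
have u0 n x : S x -> 0 <= u n x by exact: iter_kop_ge0.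
(* [q n x] bounds the increase from [u n x] to [u n.+1 x]: a copy started at [x] is coupled with one
   started at the state [y] reached after one step. *)
pose q n x := kop S K (fun y => Q n y x) x.
have q0 n x : S x -> 0 <= q n x by move=> Sx; apply: (kop_ge0 hK) => // y Sy; exact: Q0.
(* In the mean of [H y x] over [y], both [V x] and [kop V x <= V x + b] enter with factor [2 / m].
   This gives [4 / m] in front of [V x], the first term of [D], and from the bound [B] on [h] the
   second. *)
pose D := (b * (2 / m) + c0 * B)%R.
have D0 : (0 <= D)%R by rewrite addr_ge0// mulr_ge0.
have sumq N x : S x -> \sum_(0 <= n < N) q n x <= (4 / m)%:E * (V x)%:E + D%:E.
  move=> Sx; have Kx0 := (hK Sx).1; have Kx1 := (hK Sx).2.
  rewrite -wsum_sum//; last by move=> n y Sy; exact: Q0.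
  apply: (@le_trans _ _ (kop S K (fun y => (2 / m)%:E * (EFin \o V) y +
      (2 / m * V x + c0 * B)%:E) x)).
    apply: le_wsum => // y Sy; apply: le_trans (sumQ N y x Sy Sx) _.
    have -> : (2 / m * V x + c0 * B)%:E = (2 / m)%:E * (V x)%:E + (c0 * B)%:E.
      by rewrite -EFinM -EFinD.
    rewrite /H /W ge0_muleDr ?EV0// -addeA leeD2l// leeD2l// [leRHS]EFinM lee_wpmul2l//.
    by case/andP: (h01 y x Sy Sx).
  rewrite /kop wsumD//; last 2 first.
  - by move=> y Sy; rewrite mule_ge0 ?EV0.
  - by move=> y _; rewrite lee_fin addr_ge0// mulr_ge0// V0.
  rewrite wsumZ// wsum_cst//; last by rewrite addr_ge0// mulr_ge0// V0.
  apply: (@le_trans _ _ ((2 / m)%:E * (V x + b)%:E + (2 / m * V x + c0 * B)%:E)).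
    by rewrite leeD2r// lee_wpmul2l// kV.
  rewrite -!EFinM -!EFinD lee_fin /D.
  have -> : (4 / m = 2 / m + 2 / m)%R by field; rewrite gt_eqF.
  lra.
pose lV := fine (wsum S lam (EFin \o V)).
have lVE : wsum S lam (EFin \o V) = lV%:E.
  by rewrite fineK// ge0_fin_numE// wsum_ge0.
apply: (@limn_esup_le_of_drift _ _ (fun k => wsum S lam (iter k (kop S K) (EFin \o V)))
  (fun k => wsum S lam (q k)) m b (4 / m * lV + D)) => //.
- by move=> k; apply: wsum_ge0 => // x; exact: u0.
- by move=> k; apply: wsum_ge0 => // x; exact: iter_kop_ge0.
- by move=> k; apply: wsum_ge0 => // x; exact: q0.
- move=> k; rewrite -wsumZ//; [|exact: ltW|exact: u0].
  rewrite -[X in _ <= _ + X](@wsum_cst _ _ _ _ lam0 lam1)//.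
  rewrite -!wsumD//; last 3 first.
  - by move=> x; exact: iter_kop_ge0.
  - by move=> x; exact: (iter_kop_ge0 hK k.+1).
  - by move=> x Sx; rewrite mule_ge0 ?u0// lee_fin ltW.
  apply: le_wsum => // x Sx; rewrite -(iter_kopZ hK)//; last exact: ltW.
  rewrite -[in leRHS](iter_kop_cst hK k b0 Sx) iterSr -!(iter_kopD hK)//; last 2 first.
  - by move=> y Sy; exact: kop_ge0.
  - by move=> y Sy; rewrite mule_ge0 ?Ef0// lee_fin ltW.
  apply: (le_iter_kop hK) => // y Sy; exact: drift.
- move=> k; rewrite -wsumD//; [|exact: u0|exact: q0].
  apply: le_wsum => // x Sx; have Kx0 := (hK Sx).1; have Kx1 := (hK Sx).2.
  rewrite -/(u k x).
  apply: (@le_trans _ _ (kop S K (fun y => u k x + Q k y x) x)).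
    by apply: le_wsum => // y Sy; exact: (iter_kop_le_coupling hK).
  rewrite /kop wsumD//; last 2 first.
  - by move=> y _; exact: u0.
  - by move=> y Sy; exact: Q0.
  rewrite leeD2r//; have := u0 k x Sx; case: (u k x) => [t t0|_|//].
    by rewrite wsum_cst.
  by rewrite leey.
- move=> N; rewrite -wsum_sum//.
  apply: (@le_trans _ _ (wsum S lam (fun x => (4 / m)%:E * (EFin \o V) x + D%:E))).
    by apply: le_wsum => // x Sx; exact: sumq.
  have m4 : (0 <= 4 / m)%R by rewrite divr_ge0// ltW.
  rewrite wsumD//; last by move=> x Sx; rewrite mule_ge0 ?EV0.
  by rewrite wsumZ// wsum_cst// lVE.
Qed.

End Foster.

(** * Laws of countably valued random variables *)

Section CountablyValued.
Local Open Scope ereal_scope.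
Context {d : measure_display} {Om : measurableType d} {R : realType}.
Variable P : {measure set Om -> \bar R}.

Lemma bigcup_countable_measurable (I : Type) (S : set I) (F : I -> set Om) :
  countable S -> (forall i, S i -> measurable (F i)) ->
  measurable (\bigcup_(i in S) F i).
Proof.
move=> /countable_injP[g ginj] mF.
rewrite (_ : \bigcup_(i in S) F i =
  \bigcup_n \bigcup_(i in S `&` [set i | g i = n]) F i).
  apply: bigcupT_measurable => n.
  have [[i [Si gi]]|no] := pselect (exists i, S i /\ g i = n).
    rewrite (_ : \bigcup_(i in _) F i = F i); first exact: mF.
    apply/seteqP; split => [w [j [/= Sj gj] Fj]|w Fi]; last by exists i.
    by rewrite -(ginj j i) ?inE// gj gi.
  rewrite (_ : \bigcup_(i in _) F i = set0)//.
  by apply/seteqP; split => // w [j [/= Sj gj] _]; apply: no; exists j.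
apply/seteqP; split => [w [i Si Fi]|w [n _ [i [Si _] Fi]]]; last by exists i.
by exists (g i) => //; exists i.
Qed.

Lemma measure_setI_ae (A D : set Om) : measurable A -> measurable D ->
  {ae P, forall w, D w} -> P (A `&` D) = P A.
Proof.
move=> mA mD aeD; have D0 : P (~` D) = 0.
  by apply/negligibleP; [exact: measurableC|exact: aeD].
rewrite -[in RHS](setIT A) -[in RHS](setUv D) setIUr measureU; last 3 first.
- exact: measurableI.
- by apply: measurableI => //; exact: measurableC.
- by apply/seteqP; split => // w [[_ ?] [_ ?]].
rewrite [X in _ = _ + X](_ : _ = 0) ?adde0//.
apply/eqP; rewrite eq_le measure_ge0 andbT -D0 le_measure ?inE//.
  by apply: measurableI => //; exact: measurableC.
exact: measurableC.
Qed.

Context {X : choiceType}.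
Variables (Y : Om -> X) (S : set X).
Hypotheses (cS : countable S) (mY : forall y, S y -> measurable (Y @^-1` [set y])).

Lemma measurable_preimage_countable : measurable (Y @^-1` S).
Proof.
rewrite (_ : _ @^-1` _ = \bigcup_(y in S) Y @^-1` [set y]).
  exact: bigcup_countable_measurable.
by apply/seteqP; split => [w Sw|w [y Sy /= ->]//]; exists (Y w).
Qed.

(** [X] carries no sigma-algebra: [Y] is known only through its measurable fibres over a countable
    set, and any preimage is a countable union of these. *)
Lemma measurable_fun_countable d' (T : sigmaRingType d') (phi : X -> T) (D : set Om) :
  D `<=` Y @^-1` S -> measurable_fun D (phi \o Y).
Proof.
move=> DS mD B mB.
rewrite (_ : _ `&` _ = \bigcup_(y in S `&` (phi @^-1` B)) (D `&` Y @^-1` [set y])).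
  apply: bigcup_countable_measurable => [|y [Sy _]]; first by apply: sub_countable cS; apply: subset_card_le => y [].
  by apply: measurableI => //; exact: mY.
apply/seteqP; split => [w [Dw /= Bw]|w [y [Sy By] [Dw /= Yw]]].
  by exists (Y w) => //; split => //; exact: DS.
by split => //=; rewrite Yw.
Qed.

Lemma integral_countable (phi : X -> \bar R) (D : set Om) :
  measurable D -> D `<=` Y @^-1` S -> (forall y, S y -> 0 <= phi y) ->
  \int[P]_(w in D) phi (Y w) = \esum_(y in S) (phi y * P (D `&` Y @^-1` [set y])).
Proof.
move=> mD DS phi0; have /countable_injP[g ginj] := cS.
(* The injection [g] numbers the states, so that countable additivity over [nat] applies; numbers
   that code no state give empty pieces. *)
pose F n := D `&` (Y @^-1` (S `&` [set y | g y = n])).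
have Fy y : S y -> F (g y) = D `&` Y @^-1` [set y].
  move=> Sy; apply/seteqP; split => [w [Dw [/= Sw gw]]|w [Dw /= <-]].
    by split => //=; apply: ginj; rewrite ?inE.
  by split => //; split => //=; exact: DS.
have F0 n : ~ (exists2 y, S y & g y = n) -> F n = set0.
  move=> no; apply/seteqP; split => // w [Dw [/= Sw gw]].
  by apply: no; exists (Y w).
have mF n : measurable (F n).
  have [[y Sy <-]|no] := pselect (exists2 y, S y & g y = n); last by rewrite F0.
  by rewrite Fy//; apply: measurableI => //; exact: mY.
have DF : D = \bigcup_n F n.
  by apply/seteqP; split => [w Dw|w [n _ []]//]; exists (g (Y w)) => //; split => //; split => //=; exact: DS.
rewrite [in LHS]DF ge0_integral_bigcup//; last 3 first.
- by rewrite -DF; exact: measurable_fun_countable.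
- by move=> w; rewrite -DF => Dw; apply: phi0; exact: DS.
- apply/trivIsetP => i j _ _ ij; apply/seteqP; split => // w [[_ [/= _ gi]] [_ [/= _ gj]]].
  by move/eqP: ij; apply; rewrite -gi -gj.
rewrite nneseries_esumT; last first.
  by move=> n; apply: integral_ge0 => w [Dw _]; apply: phi0; exact: DS.
pose a n := \int[P]_(w in F n) phi (Y w).
rewrite -/a (_ : \esum_(i in [set: nat]) a i = \esum_(i in g @` S) a i).
  rewrite (esum_image S g a) => [|x y]; last exact: ginj.
  apply: eq_esum => y Sy; rewrite /a Fy//.
  rewrite -integral_cst; last by apply: measurableI => //; exact: mY.
  by apply: eq_integral => w; rewrite inE => -[_ /= ->].
rewrite [RHS]esum_mkcond; apply: eq_esum => n _; case: ifPn => //.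
by rewrite notin_setE => no; rewrite /a F0 ?integral_set0.
Qed.

Lemma measure_countable (D : set Om) : measurable D -> D `<=` Y @^-1` S ->
  P D = \esum_(y in S) P (D `&` Y @^-1` [set y]).
Proof.
move=> mD DS; rewrite -[LHS]mul1e -integral_cst//.
rewrite (@integral_countable (fun=> 1))//.
by apply: eq_esum => y _; rewrite mul1e.
Qed.

Lemma measure_countable_ae (D : set Om) : measurable D -> {ae P, forall w, S (Y w)} ->
  P D = \esum_(y in S) P (D `&` Y @^-1` [set y]).
Proof.
move=> mD aeS; have mS := measurable_preimage_countable.
rewrite -(measure_setI_ae mD mS aeS) measure_countable//; last exact: measurableI.
apply: eq_esum => y Sy; congr (P _); apply/seteqP; split => w.
  by move=> [[Dw _] yw].
by move=> [Dw /= yw]; split => //; split => //=; rewrite yw.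
Qed.

End CountablyValued.

(** * One-time laws of a Markov chain as iterates of its operator *)

Section MarkovLaw.
Local Open Scope ereal_scope.
Context {d : measure_display} {Om : measurableType d} {R : realType}.
Context {P : probability Om R} {X : choiceType} {S : set X}.
Variable Z : nat -> Om -> X.
Hypotheses (cS : countable S)
  (mZ : forall k y, measurable (Z k @^-1` [set y]))
  (aeS : forall k, {ae P, forall w, S (Z k w)}).

Definition path_event (k : nat) (x : nat -> X) : set Om :=
  [set w | forall j, (j <= k)%N -> Z j w = x j].

(* The states before time [k] are summed out one at a time. *)
Lemma marginal_product_rule (k : nat) (A : set Om) (kappa : X -> R) :
  measurable A -> (forall y, S y -> 0 <= kappa y)%R ->
  (forall x, (forall j, S (x j)) ->
    P (path_event k x `&` A) = P (path_event k x) * (kappa (x k))%:E) ->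
  forall y, S y -> P (Z k @^-1` [set y] `&` A) = P (Z k @^-1` [set y]) * (kappa y)%:E.
Proof.
move=> mA k0 rule.
(* [G j x] prescribes the states at times [j] to [k] only: [j = 0] is the hypothesis [rule], [j = k]
   the goal. *)
pose G j (x : nat -> X) := [set w | forall i, (j <= i <= k)%N -> Z i w = x i].
have mG j x : measurable (G j x).
  rewrite (_ : G j x = \bigcap_(i in [set i | (j <= i <= k)%N]) (Z i @^-1` [set x i])).
    by apply: bigcap_measurableType => i _; exact: mZ.
  by apply/seteqP; split.
suff main j x : (j <= k)%N -> (forall i, S (x i)) ->
    P (G j x `&` A) = P (G j x) * (kappa (x k))%:E.
  move=> y Sy; have := main k (fun=> y) (leqnn k) (fun=> Sy).
  rewrite (_ : G k _ = Z k @^-1` [set y])//; apply/seteqP; split => w /=.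
    by move=> /(_ k); rewrite leqnn; exact.
  by move=> Zy i; rewrite -eqn_leq => /eqP <-.
elim: j x => [|j ih] x jk Sx.
  rewrite (_ : G 0%N x = path_event k x); first exact: rule.
  by apply/seteqP; split => w h i ik; apply: h.
pose xy y i := if i == j then y else x i.
have GE y : G j.+1 x `&` Z j @^-1` [set y] = G j (xy y).
  apply/seteqP; split => [w [h /= hy] i /andP[ji ik]|w h].
    by rewrite /xy; case: eqVneq => [->//|ij]; apply: h; rewrite ltn_neqAle eq_sym ij ji.
  split => [i /andP[ji ik]|/=].
    by have := h i; rewrite (ltnW ji) ik /xy gtn_eqF//; exact.
  by have := h j; rewrite leqnn (ltnW jk) /xy eqxx; exact.
have Sxy y : S y -> forall i, S (xy y i) by move=> Sy i; rewrite /xy; case: ifP.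
have e1 : P (G j.+1 x `&` A) = \esum_(y in S) P (G j (xy y) `&` A).
  rewrite (measure_countable_ae cS _ (measurableI _ _ (mG _ _) mA) (aeS j)) //.
  by apply: eq_esum => y Sy; rewrite setIAC GE.
have e2 : P (G j.+1 x) = \esum_(y in S) P (G j (xy y)).
  rewrite (measure_countable_ae cS _ (mG _ _) (aeS j)) //.
  by apply: eq_esum => y Sy; rewrite GE.
rewrite e1 e2 muleC -esumZl//; last exact: k0.
apply: eq_esum => y Sy; rewrite ih ?(ltnW jk)//; last exact: Sxy.
by rewrite /xy gtn_eqF// muleC.
Qed.

Variable K : X -> X -> R.
Hypotheses (hK : transition_matrix S K) (markovZ : markov_chain S K P Z).

Definition law (k : nat) (x : X) : R := fine (P (Z k @^-1` [set x])).

Lemma lawE k x : (law k x)%:E = P (Z k @^-1` [set x]).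
Proof. by rewrite fineK// fin_num_measure. Qed.

Lemma law_ge0 k x : (0 <= law k x)%R. Proof. exact: fine_ge0. Qed.

Lemma law_sum1 k : \esum_(x in S) (law k x)%:E = 1.
Proof.
rewrite -(probability_setT P) (measure_countable_ae cS _ measurableT (aeS k))//.
by apply: eq_esum => x _; rewrite setTI lawE.
Qed.

(** The Markov property is given for complete histories; the past before time [k] is summed out with
    the event that the next state is [y]. *)
Lemma markov_one_step k x y : S x -> S y ->
  P (Z k @^-1` [set x] `&` Z k.+1 @^-1` [set y]) = P (Z k @^-1` [set x]) * (K x y)%:E.
Proof.
move=> Sx Sy; apply: (@marginal_product_rule k _ (K ^~ y)) => //.
  by move=> z Sz; exact: (hK Sz).1.
move=> p Sp; pose p' i := if i == k.+1 then y else p i.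
have Sp' j : S (p' j) by rewrite /p'; case: ifP.
have p'E i : (i <= k)%N -> p' i = p i by move=> ik; rewrite /p' ltn_eqF.
have := markovZ.2 k p' Sp'; rewrite p'E// [p' k.+1]/p' eqxx.
rewrite (_ : [set w | forall j, (j <= k)%N -> _] = path_event k p); last first.
  by apply/seteqP; split => w h j jk; rewrite h// p'E.
move=> <-; congr (P _); apply/seteqP; split => w.
  move=> [h /= Zy] j; rewrite leq_eqVlt => /predU1P[->|jk]; last by rewrite h// p'E.
  by rewrite /p' eqxx.
move=> h; split => [j jk|/=]; first by rewrite h ?p'E// (leq_trans jk).
by rewrite h// /p' eqxx.
Qed.

(** Both sides integrate [phi (Z k.+1)] over the event that both states lie in [S], once by the law
    of the later state and once by the joint law. *)
Lemma markov_law_next k (phi : X -> \bar R) : (forall x, S x -> 0 <= phi x) ->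
  wsum S (law k.+1) phi = wsum S (law k) (kop S K phi).
Proof.
move=> phi0; pose Y w := (Z k w, Z k.+1 w).
have mY (p : X * X) : measurable (Y @^-1` [set p]).
  rewrite (_ : _ @^-1` _ = Z k @^-1` [set p.1] `&` Z k.+1 @^-1` [set p.2]).
    by apply: measurableI; exact: mZ.
  by apply/seteqP; split => w; rewrite /Y /=; case: p => p1 p2 /= [-> ->].
have mS i : measurable (Z i @^-1` S) by exact: measurable_preimage_countable.
pose D := Y @^-1` (S `*` S).
have DE : D = Z k @^-1` S `&` Z k.+1 @^-1` S by apply/seteqP; split.
have mD : measurable D by rewrite DE; exact: measurableI.
have aeD : {ae P, forall w, D w}.
  by move: (aeS k) (aeS k.+1); apply: filterS2 => w h1 h2.
transitivity (\int[P]_(w in D) phi (Z k.+1 w)).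
  rewrite (integral_countable _ cS)//; last by move=> w [].
  apply: eq_esum => y Sy; rewrite lawE muleC; congr (_ * _).
  by rewrite [in RHS]setIC measure_setI_ae.
have cSS : countable (S `*` S) by exact: countableX.
rewrite (@integral_countable _ _ _ _ _ Y (S `*` S) cSS _ (fun p => phi p.2))//; last first.
  by move=> p [_ ?]; exact: phi0.
transitivity (\esum_(p in S `*`` (fun=> S)) ((law k p.1)%:E * ((K p.1 p.2)%:E * phi p.2))).
  apply: eq_esum => -[x y] [/= Sx Sy]; rewrite muleA lawE -markov_one_step// muleC.
  congr (P _ * _); apply/seteqP; split => w; rewrite /Y /=.
    by move=> [_ [-> ->]].
  by move=> [zx zy]; rewrite zx zy; split => //; split; rewrite /= ?zx ?zy.
rewrite -(@esum_esum _ _ _ S (fun=> S) (fun x y => (law k x)%:E * ((K x y)%:E * phi y))).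
  apply: eq_esum => x Sx; rewrite esumZl ?law_ge0// => y Sy.
  by rewrite mule_ge0 ?phi0// lee_fin (hK Sx).1.
move=> x y Sx Sy; apply: mule_ge0; first by rewrite lee_fin law_ge0.
by apply: mule_ge0; [rewrite lee_fin (hK Sx).1|exact: phi0].
Qed.

Lemma markov_law_iter k (phi : X -> \bar R) : (forall x, S x -> 0 <= phi x) ->
  wsum S (law k) phi = wsum S (law 0) (iter k (kop S K) phi).
Proof.
elim: k phi => // k ih phi phi0; rewrite markov_law_next// ih ?iterSr//.
exact: kop_ge0.
Qed.

(** Some state has positive initial probability, and positive transitions carry this along a path to
    [x]. It lets facts about the process be transferred to the kernel at every [x] of the chain
    space. *)
Lemma law_pos x : irreducible_chain S K -> S x -> exists k, (0 < law k x)%R.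
Proof.
move=> irr Sx; have [y Sy ly] : exists2 y, S y & 0 < (law 0 y)%:E.
  by apply: esum_gt0_term; rewrite law_sum1 lte01.
have [n yx] := irr y x Sy Sx; elim: n y Sy yx {ly} 0%N ly => [|n ih] y Sy yx j ly.
  by exists j; move: yx ly; rewrite /=; have [->|] := eqVneq y x; rewrite ?ltxx.
have [z [Sz Kyz zx]] := kstepS_gt0 hK Sy yx.
apply: (ih z Sz zx j.+1); apply: (@lt_le_trans _ _ ((law j y)%:E * (K y z)%:E)).
  by rewrite mule_gt0.
rewrite !lawE -markov_one_step// le_measure ?inE//; first exact: measurableI.
Qed.

End MarkovLaw.

(** * Binomial moments and concave utilities *)

Section BinomialMoments.
Context {R : realType}.
Variable p : R.

Lemma sum_binomial_pmf n : \sum_(j < n.+1) binomial_pmf n p j = 1.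
Proof.
have := exprDn (1 - p) p n; rewrite subrK expr1n => ->.
by apply: eq_bigr => j _; rewrite /binomial_pmf mulrC.
Qed.

(** Absorption identity for binomial coefficients; [h = 1] and [h j = j] give the first two
    moments. *)
Lemma sum_mul_binomial_pmf n (h : nat -> R) :
  \sum_(j < n.+2) j%:R * h j * binomial_pmf n.+1 p j =
  n.+1%:R * p * \sum_(i < n.+1) h i.+1 * binomial_pmf n p i.
Proof.
rewrite big_ord_recl /= !mul0r add0r mulr_sumr; apply: eq_bigr => i _.
have pmfE k j : binomial_pmf k p j = p ^+ j * (1 - p) ^+ (k - j) * 'C(k, j)%:R.
  by rewrite mulr_natr.
rewrite !pmfE /bump /= add1n subSS exprS.
have := mul_bin_diag n.+1 i; rewrite /= => /(congr1 (fun k => k%:R : R)).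
rewrite !natrM => e.
transitivity (i.+1%:R * 'C(n.+1, i.+1)%:R * (h i.+1 * (p * p ^+ i * (1 - p) ^+ (n - i)))).
  by ring.
by rewrite -e; ring.
Qed.

Lemma binomial_moment1 n : \sum_(j < n.+1) j%:R * binomial_pmf n p j = n%:R * p.
Proof.
case: n => [|n]; first by rewrite big_ord1 !mul0r.
have := sum_mul_binomial_pmf n (fun=> 1).
under eq_bigr do rewrite mulr1; move=> ->.
by under eq_bigr do rewrite mul1r; rewrite sum_binomial_pmf mulr1.
Qed.

Lemma binomial_moment2 n : \sum_(j < n.+1) j%:R ^+ 2 * binomial_pmf n p j =
  n%:R * p * (1 - p) + n%:R ^+ 2 * p ^+ 2.
Proof.
case: n => [|n]; first by rewrite big_ord1 expr2 !mul0r addr0.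
have := sum_mul_binomial_pmf n (fun j => j%:R).
under eq_bigr do rewrite -expr2; move=> ->.
under eq_bigr do rewrite -natr1 mulrDl mul1r.
rewrite big_split /= binomial_moment1 sum_binomial_pmf -natr1; ring.
Qed.

Lemma esum_binomial_pmf n (h : nat -> R) : 0 <= p <= 1 -> (forall j, 0 <= h j) ->
  \esum_(j in [set: nat]) (h j * binomial_pmf n p j)%:E =
  (\sum_(j < n.+1) h j * binomial_pmf n p j)%:E.
Proof.
move=> p01 h0; rewrite (esumID `I_n.+1)//; last first.
  by move=> j _; rewrite lee_fin mulr_ge0// binomial_pmf_ge0.
rewrite [X in (_ + X)%E]esum1 ?adde0; last first.
  move=> j [_ /= /negP]; rewrite -leqNgt => nj.
  by rewrite /binomial_pmf bin_small// mulr0n mulr0.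
rewrite setTI esum_fset//; last first.
  by move=> j _; rewrite lee_fin mulr_ge0// binomial_pmf_ge0.
by rewrite -fsbig_ord//= sumEFin.
Qed.

End BinomialMoments.

Section ConcaveBound.
Context {R : realType}.
Variables (U : R -> R) (Xm : R).
Hypothesis U_concave : convex_function (`[0, +oo[ : set R^o) (fun x : R^o => - U x).

Lemma concave_chord (t x y : R) : 0 <= t <= 1 -> 0 <= x -> 0 <= y ->
  t * U x + (1 - t) * U y <= U (t * x + (1 - t) * y).
Proof.
move=> /andP[t0 t1] x0 y0.
have mem (z : R) : 0 <= z -> z \in (`[0, +oo[%classic : set R^o) by move=> z0; rewrite inE /= in_itv /= z0.
have : - U (t * x + (1 - t) * y) <= t * - U x + (1 - t) * - U y.
  exact: (U_concave (Itv01 t0 t1) (mem x x0) (mem y y0)).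
lra.
Qed.

(** Guarantees that the supremum in [B5_bound] really bounds the utilities. A concave function lies
    above its smaller endpoint value [m]; comparing [x] and its mirror image [Xm - x] with the
    midpoint gives the upper bound. *)
Lemma concave_bounded : has_ubound [set 2 * `|U x| | x in `[0, Xm]].
Proof.
pose m := Num.min (U 0) (U Xm).
have low x : 0 <= x <= Xm -> m <= U x.
  move=> /andP[x0 xX]; have [X0|X0] := leP Xm 0.
    have -> : x = 0 by lra.
    by rewrite ge_min lexx.
  have tx : 0 <= x / Xm <= 1 by rewrite divr_ge0 ?(ltW X0)// ler_pdivrMr// mul1r.
  have := concave_chord tx (ltW X0) (lexx 0).
  rewrite mulr0 addr0 divfK ?gt_eqF//; apply: le_trans.
  have m1 : m <= U Xm by rewrite ge_min lexx orbT.
  have m2 : m <= U 0 by rewrite ge_min lexx.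
  case/andP: tx => t0 t1; rewrite -[m](_ : x / Xm * m + (1 - x / Xm) * m = m).
    by apply: lerD; apply: ler_wpM2l => //; rewrite subr_ge0.
  by rewrite -mulrDl subrKC mul1r.
have up x : 0 <= x <= Xm -> U x <= 2 * U (Xm / 2) - m.
  move=> /andP[x0 xX].
  have h : 0 <= (2^-1 : R) <= 1 by lra.
  have xX0 : 0 <= Xm - x by lra.
  have := concave_chord h x0 xX0.
  have -> : 2^-1 * x + (1 - 2^-1) * (Xm - x) = Xm / 2 by field.
  have := low (Xm - x); lra.
exists (2 * (`|m| + `|2 * U (Xm / 2) - m|)) => _ [x /= + <-].
rewrite in_itv /= => hx.
rewrite ler_pM2l// ler_norml; have := low x hx; have := up x hx.
have := ler_norm m; have := ler_norm (- m); rewrite normrN.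
have := ler_norm (2 * U (Xm / 2) - m); have := normr_ge0 (2 * U (Xm / 2) - m).
have := normr_ge0 m.
by move=> *; apply/andP; split; lra.
Qed.

(** The origin of the factor 2 in [B5_bound]: [|U y| + |U z|] is the average of [2 |U y|] and
    [2 |U z|]. *)
Lemma concave_diff_le_sup y z : 0 <= y <= Xm -> 0 <= z <= Xm ->
  U y - U z <= sup [set 2 * `|U x| | x in `[0, Xm]].
Proof.
move=> hy hz; have b t : 0 <= t <= Xm -> 2 * `|U t| <= sup [set 2 * `|U x| | x in `[0, Xm]].
  by move=> ht; apply: ub_le_sup concave_bounded _ _; exists t => //=; rewrite in_itv.
have := b _ hy; have := b _ hz; have := ler_norm (U y); have := ler_norm (- U z).
rewrite normrN; lra.
Qed.

End ConcaveBound.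

(** * Comparison with the static solution *)

(** [has_sum] is a difference of two nonnegative sums, so the comparison is made with all negative
    parts moved to the right, where the sum of [g] may be infinite. *)
Lemma has_sum_lincomb_le (R : realType) (I : choiceType) (J : finType)
    (c m : J -> R) (F : J -> I -> R) (g : I -> R) :
  (forall j, 0 <= c j) -> (forall j, has_sum (F j) (m j)) ->
  (forall i, 0 <= g i) -> (forall i, \sum_j c j * F j i <= g i) ->
  ((\sum_j c j * m j)%:E <= \esum_(i in [set: I]) (g i)%:E)%E.
Proof.
move=> c0 hF g0 Fg.
pose Fp j i := Num.max (F j i) 0; pose Fm j i := Num.max (- F j i) 0.
have Fp0 j i : 0 <= Fp j i by rewrite le_max lexx orbT.
have Fm0 j i : 0 <= Fm j i by rewrite le_max lexx orbT.
have FE j i : F j i = Fp j i - Fm j i.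
  rewrite /Fp /Fm; have [h|h] := leP (F j i) 0.
    by rewrite max_l ?oppr_ge0// sub0r opprK.
  by rewrite max_r ?subr0// oppr_le0 ltW.
have /choice[sp hsp] : forall j, exists ab : R * R,
    [/\ \esum_(i in [set: I]) (Fp j i)%:E = ab.1%:E,
        \esum_(i in [set: I]) (Fm j i)%:E = ab.2%:E & m j = ab.1 - ab.2].
  move=> j; have [_] := hF j.
  have -> : \esum_(i in [set: I]) (EFin \o F j)^\+%E i = \esum_(i in [set: I]) (Fp j i)%:E.
    by apply: eq_esum => i _; rewrite funeposE /Fp /= EFin_max.
  have -> : \esum_(i in [set: I]) (EFin \o F j)^\-%E i = \esum_(i in [set: I]) (Fm j i)%:E.
    by apply: eq_esum => i _; rewrite funenegE /Fm /= EFin_max EFinN.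
  case: (\esum_(i in _) _) => [a| |]; case: (\esum_(i in _) _) => [b| |]// [e].
  by exists (a, b); split.
have key : (\sum_j (c j)%:E * (sp j).1%:E <=
    \esum_(i in [set: I]) (g i)%:E + \sum_j (c j)%:E * (sp j).2%:E)%E.
  have -> : (\sum_j (c j)%:E * (sp j).1%:E =
      \esum_(i in [set: I]) \sum_j (c j)%:E * (Fp j i)%:E)%E.
    rewrite esum_sum => [|i j _ _]; last by rewrite -EFinM lee_fin mulr_ge0.
    by apply: eq_bigr => j _; have [<- _ _] := hsp j; rewrite esumZl// => i _; rewrite lee_fin.
  have -> : (\sum_j (c j)%:E * (sp j).2%:E =
      \esum_(i in [set: I]) \sum_j (c j)%:E * (Fm j i)%:E)%E.
    rewrite esum_sum => [|i j _ _]; last by rewrite -EFinM lee_fin mulr_ge0.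
    by apply: eq_bigr => j _; have [_ <- _] := hsp j; rewrite esumZl// => i _; rewrite lee_fin.
  rewrite -esumD; [|by move=> i _; rewrite lee_fin|]; last first.
    by move=> i _; apply: sume_ge0 => j _; rewrite -EFinM lee_fin mulr_ge0.
  apply: le_esum => i _; rewrite (eq_bigr (fun j => (c j * Fp j i)%:E))//.
  rewrite [X in (_ + X)%E](eq_bigr (fun j => (c j * Fm j i)%:E))//.
  rewrite !sumEFin -EFinD lee_fin -lerBlDr -sumrB; apply: le_trans (Fg i).
  by apply: ler_sum => j _; rewrite FE mulrBr.
move: key; rewrite (eq_bigr (fun j => (c j * (sp j).1)%:E))//.
rewrite [X in (_ <= _ + X)%E -> _](eq_bigr (fun j => (c j * (sp j).2)%:E))// !sumEFin.
have : (0 <= \esum_(i in [set: I]) (g i)%:E)%E by apply: esum_ge0 => i _; rewrite lee_fin.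
case: (\esum_(i in _) _)%E => [t| |]// _; rewrite ?leey// -EFinD !lee_fin => h.
rewrite (eq_bigr (fun j => c j * (sp j).1 - c j * (sp j).2)); last first.
  by move=> j _; have [_ _ ->] := hsp j; rewrite mulrBr.
by rewrite sumrB; lra.
Qed.

Section StaticComparison.
Context {R : realType} {L : finType}.
Variable N : network R L.

Lemma countable_pvec : countable [set: pvec L].
Proof.
apply/countable_injP; exists (fun v => choice.pickle [ffun l => v l]) => v v' _ _.
move=> /(pcan_inj choice.pickleK)/ffunP e; apply/funext => l.
by have := e l; rewrite !ffunE.
Qed.

(** Turns the sums over schedules in the static problem into ordinary finite sums. Every entry of a
    schedule is at most the total capacity [B]. *)
Lemma feasible_finite (a c : pvec L) : finite_set (feasible (N := N) a c).
Proof.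
pose B := (\sum_l c l)%N.
pose T := {ffun L * 'I_(slots N) -> 'I_B.+1}.
pose phi (fg : T * T) : schedule N :=
  (fun l t => fg.1 (l, t) : nat, fun l t => fg.2 (l, t) : nat).
apply: (@sub_finite_set _ _ (phi @` [set: T * T])); last by apply: finite_image; exact: finite_finset.
move=> [s1 s2] [_ _ /= hc].
have leB l t : (s1 l t + s2 l t <= B)%N.
  by apply: leq_trans (hc l t) _; rewrite /B (bigD1 l)//= leq_addr.
exists ([ffun lt => inord (s1 lt.1 lt.2)], [ffun lt => inord (s2 lt.1 lt.2)]) => //.
congr pair; apply/funext => l; apply/funext => t; rewrite ffunE /= inordK// ltnS.
  by apply: leq_trans (leB l t); rewrite leq_addr.
by apply: leq_trans (leB l t); rewrite leq_addl.
Qed.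

Lemma feasible0 (a c : pvec L) :
  feasible (N := N) a c ((fun _ _ => 0%N), (fun _ _ => 0%N)).
Proof. by split => // l; rewrite /inel_total /= big1. Qed.

Lemma el_total_le (a c : pvec L) (s : schedule N) l :
  feasible a c s -> (el_total s l <= slots N * c l)%N.
Proof.
move=> [_ _ hc]; rewrite /el_total; apply: (@leq_trans (\sum_(t < slots N) c l)).
  by apply: leq_sum => t _; apply: leq_trans (hc l t); rewrite leq_addl.
by rewrite sum_nat_const card_ord.
Qed.

Variables (v : static_vars N) (eps : R) (x : state R L).
Hypotheses (hN : network_spec N) (hv : static_feasible v).
Hypotheses (eps0 : 0 < eps) (x1 : forall l, 0 <= x.1 l) (x2 : forall l, 0 <= x.2 l).

Let c1 l := eps^-1 * weight N l + x.1 l.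

Let c1_ge0 l : 0 <= c1 l.
Proof. by rewrite addr_ge0// mulr_ge0// ?(weight_ge0 hN)// invr_ge0 ltW. Qed.

Lemma sched_weight_ge0 a c (s : schedule N) : scheduler_argmax eps a c x s -> 0 <= sched_weight eps x s.
Proof.
move=> [_ /(_ _ (feasible0 a c))]; apply: le_trans.
apply: sumr_ge0 => l _; rewrite addr_ge0// mulr_ge0//.
exact: c1_ge0.
Qed.

(** The static rates are averages over schedules of weight at most [M]. The probabilities may add up
    to less than 1, which is harmless because the idle schedule forces [M >= 0]. *)
Lemma static_le_argmax a c (s : schedule N) : scheduler_argmax eps a c x s ->
  \sum_l (c1 l * mu_i_at v a c l + x.2 l * mu_e_at v a c l) <= sched_weight eps x s.
Proof.
move=> hs; have M0 := sched_weight_ge0 hs; set M := sched_weight _ _ _ in M0 *.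
have fin := feasible_finite a c.
pose r := finmap.enum_fset (fset_set (feasible (N := N) a c)).
have rP s' : s' \in r -> feasible a c s' by rewrite in_fset_set// inE.
have p1 : \sum_(s' <- r) sched_prob v a c s' <= 1.
  by have := sched_prob_le1 hv a c; rewrite fsbig_finite.
have hi l : mu_i_at v a c l <= \sum_(s' <- r) ((inel_total s' l)%:R * sched_prob v a c s').
  by have := mu_i_at_le hv a c l; rewrite fsbig_finite.
have he l : mu_e_at v a c l <= \sum_(s' <- r) ((el_total s' l)%:R * sched_prob v a c s').
  by have := mu_e_at_le hv a c l; rewrite fsbig_finite.
apply: (@le_trans _ _ (\sum_l \sum_(s' <- r)
    ((c1 l * (inel_total s' l)%:R + x.2 l * (el_total s' l)%:R) * sched_prob v a c s'))).
  apply: ler_sum => l _.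
  rewrite (eq_bigr (fun s' => c1 l * ((inel_total s' l)%:R * sched_prob v a c s') +
    x.2 l * ((el_total s' l)%:R * sched_prob v a c s'))); last by move=> s' _; ring.
  rewrite big_split /= -!mulr_sumr lerD// ler_wpM2l//; exact: c1_ge0.
rewrite exchange_big /=; apply: (@le_trans _ _ (\sum_(s' <- r) M * sched_prob v a c s')).
  rewrite !big_seq; apply: ler_sum => s' /rP fs'.
  rewrite -mulr_suml ler_wpM2r ?(sched_prob_ge0 hv)//; exact: hs.2.
by rewrite -mulr_sumr -[leRHS]mulr1 ler_wpM2l.
Qed.

Lemma static_le_mean_argmax (sc : pvec L -> pvec L -> schedule N) :
  (forall a c, scheduler_argmax eps a c x (sc a c)) ->
  ((\sum_l (c1 l * mu_i v l + x.2 l * mu_e v l))%:E <=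
   \esum_(ac in [set: pvec L * pvec L])
     (sched_weight eps x (sc ac.1 ac.2) * (arr_law N ac.1 * chan_law N ac.2))%:E)%E.
Proof.
move=> hsc.
have A0 := (arr_pmf hN).1; have C0 := (chan_pmf hN).1.
pose c j := match j with inl l => c1 l | inr l => x.2 l end.
pose m j := match j with inl l => mu_i v l | inr l => mu_e v l end.
pose F j (ac : pvec L * pvec L) := match j with
  | inl l => mu_i_at v ac.1 ac.2 l * chan_law N ac.2 * arr_law N ac.1
  | inr l => mu_e_at v ac.1 ac.2 l * chan_law N ac.2 * arr_law N ac.1 end.
have -> : \sum_l (c1 l * mu_i v l + x.2 l * mu_e v l) = \sum_(j : L + L) c j * m j.
  by rewrite big_sumType big_split.
apply: (@has_sum_lincomb_le _ _ _ c m F).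
- by case=> l; [exact: c1_ge0|exact: x2].
- by case=> l; [exact: (mu_iE hv)|exact: (mu_eE hv)].
- by move=> ac; rewrite mulr_ge0 ?(sched_weight_ge0 (hsc _ _))// mulr_ge0.
- move=> ac; rewrite big_sumType /= -big_split /=.
  rewrite (eq_bigr (fun l => (c1 l * mu_i_at v ac.1 ac.2 l + x.2 l * mu_e_at v ac.1 ac.2 l) *
    (arr_law N ac.1 * chan_law N ac.2))); last by move=> l _; ring.
  by rewrite -mulr_suml ler_wpM2r ?mulr_ge0// static_le_argmax.
Qed.

End StaticComparison.

(** * Drift of the quadratic Lyapunov function *)

Section MeanBound.
Context {R : realType} {d : measure_display} {Om : measurableType d}.
Variables (P : probability Om R) (D : set Om).
Hypothesis mD : measurable D.

(* Conditional mean given [D], multiplied through by [P D] so that [P D = 0] is allowed. *)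
Definition mean_le (g : Om -> R) (m : R) : Prop :=
  [/\ measurable_fun D g, forall w, 0 <= g w &
      (\int[P]_(w in D) (g w)%:E <= m%:E * P D)%E].

Lemma mean_le_cst c : 0 <= c -> mean_le (fun=> c) c.
Proof. by move=> c0; split => //; rewrite integral_cst. Qed.

Lemma mean_leD g h m n : mean_le g m -> mean_le h n ->
  mean_le (fun w => g w + h w) (m + n).
Proof.
move=> [mg g0 gm] [mh h0 hn]; split.
- exact: measurable_funD.
- by move=> w; rewrite addr_ge0.
- under eq_integral do rewrite EFinD.
  rewrite ge0_integralD//; last 4 first.
  - by move=> w _; rewrite lee_fin.
  - exact/measurable_EFinP.
  - by move=> w _; rewrite lee_fin.
  - exact/measurable_EFinP.
  rewrite EFinD -[P D]fineK ?fin_num_measure// muleDl// leeD// fineK ?fin_num_measure//.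
Qed.

Lemma mean_leZ c g m : 0 <= c -> mean_le g m -> mean_le (fun w => c * g w) (c * m).
Proof.
move=> c0 [mg g0 gm]; split.
- exact: measurable_funM.
- by move=> w; rewrite mulr_ge0.
- under eq_integral do rewrite EFinM.
  rewrite ge0_integralZl_EFin//.
  - by rewrite EFinM -muleA lee_wpmul2l.
  - by move=> w _; rewrite lee_fin.
  - exact/measurable_EFinP.
Qed.

Lemma mean_le_sum (I : Type) (s : seq I) (g : I -> Om -> R) (m : I -> R) :
  (forall i, mean_le (g i) (m i)) ->
  mean_le (fun w => \sum_(i <- s) g i w) (\sum_(i <- s) m i).
Proof.
move=> gm; elim: s => [|i s ih].
  by under [X in mean_le X]eq_fun do rewrite big_nil; rewrite big_nil; exact: mean_le_cst.
under [X in mean_le X]eq_fun do rewrite big_cons.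
by rewrite big_cons; exact: mean_leD.
Qed.

End MeanBound.

Section PacketMoments.
Context {R : realType} {L : finType}.
Variable Q : pvec L -> R.
Hypothesis hQ : packet_pmf Q.
Local Open Scope ereal_scope.

Let Q0 := hQ.1.

Lemma has_mean_ge0 l m : has_mean Q l m -> (0 <= m)%R.
Proof.
by move=> h; rewrite -lee_fin -h; apply: esum_ge0 => v _; rewrite lee_fin mulr_ge0.
Qed.

(** The identity [v^2 + m^2 = (v - m)^2 + 2 m v] has nonnegative terms on both sides, so it can be
    summed before finiteness is known. *)
Lemma second_moment l m s2 : has_mean Q l m -> has_variance Q l m s2 ->
  \esum_(v in [set: pvec L]) ((v l)%:R ^+ 2 * Q v)%:E = (m ^+ 2 + s2)%:E.
Proof.
move=> hm hs; have m0 := has_mean_ge0 hm.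
have e : \esum_(v in [set: pvec L]) ((v l)%:R ^+ 2 * Q v)%:E + (m ^+ 2)%:E =
    s2%:E + (2 * m * m)%:E.
  transitivity (\esum_(v in [set: pvec L])
      (((v l)%:R ^+ 2 * Q v)%:E + (m ^+ 2)%:E * (Q v)%:E)).
    rewrite esumD.
    - by rewrite esumZl ?sqr_ge0// ?hQ.2 ?mule1// => v _; rewrite lee_fin.
    - by move=> v _; rewrite lee_fin mulr_ge0// sqr_ge0.
    - by move=> v _; rewrite -EFinM lee_fin mulr_ge0// sqr_ge0.
  transitivity (\esum_(v in [set: pvec L])
      ((((v l)%:R - m) ^+ 2 * Q v)%:E + (2 * m)%:E * ((v l)%:R * Q v)%:E)).
    by apply: eq_esum => v _; rewrite -!EFinM -!EFinD; congr EFin; ring.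
  rewrite esumD.
  - rewrite esumZl ?mulr_ge0// ?hs ?hm ?EFinM//.
    by move=> v _; rewrite lee_fin mulr_ge0.
  - by move=> v _; rewrite lee_fin mulr_ge0// sqr_ge0.
  - by move=> v _; rewrite -EFinM lee_fin !mulr_ge0.
move: e; case: (\esum_(i in _) _) => [t| |]//.
by rewrite -!EFinD => -[e]; congr EFin; lra.
Qed.

End PacketMoments.

(** Truncation at 0 only decreases the square; expanding it, the cross term [- al * I] is dropped
    and [I] is bounded by [a]. The service term [u * I] stays on the left for comparison with the
    static solution. *)
Lemma reflected_step_le (R : realFieldType) (u al I a : R) : 0 <= u -> 0 <= al -> 0 <= I -> I <= a ->
  2^-1 * Num.max (u + al - I) 0 ^+ 2 + u * I <=
  2^-1 * u ^+ 2 + (2^-1 * (al ^+ 2 + a ^+ 2) + u * al).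
Proof.
move=> u0 al0 I0 Ia.
have h1 : Num.max (u + al - I) 0 ^+ 2 <= (u + al - I) ^+ 2.
  have [h|h] := leP (u + al - I) 0; last by [].
  by rewrite expr0n /= sqr_ge0.
have h2 : I ^+ 2 <= a ^+ 2 by rewrite lerXn2r// nnegrE (le_trans I0).
have h3 : 0 <= al * I by rewrite mulr_ge0.
have -> : 2^-1 * u ^+ 2 + (2^-1 * (al ^+ 2 + a ^+ 2) + u * al) =
   2^-1 * ((u + al - I) ^+ 2 + 2 * (al * I) + (a ^+ 2 - I ^+ 2)) + u * I by field.
rewrite lerD2r ler_pM2l ?invr_gt0//; lra.
Qed.

Section Drift.
Context {R : realType} {L : finType}.
Variable N : network R L.
Hypothesis hN : network_spec N.
Variables (d : measure_display) (Om : measurableType d) (P : probability Om R).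
Variables (Z : process N P) (eps Xmax sigma_e : R).
Hypothesis (hZ : online eps Xmax sigma_e Z).

Let S := chain_space Z.
Let K := chain_kernel Z.
Let cS : countable S := space_countable hZ.
Let hK : transition_matrix S K := chain_transition hZ.
Let A0 v : 0 <= arr_law N v := (arr_pmf hN).1 v.
Let C0 v : 0 <= chan_law N v := (chan_pmf hN).1 v.

Lemma measurable_fiber d' (T : measurableType d') (X : {RV P >-> T}) (B : set T) :
  measurable B -> measurable (X @^-1` B).
Proof. by move=> mB; rewrite -[X in measurable X]setTI; exact: measurable_funP. Qed.

Lemma measurable_state k x : measurable (state_at Z k @^-1` [set x]).
Proof.
rewrite (_ : _ @^-1` _ = \bigcap_(l in [set: L])
    (deficit Z k l @^-1` [set x.1 l] `&` queue Z k l @^-1` [set x.2 l])).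
  apply: fin_bigcap_measurable; first exact: finite_finset.
  by move=> l _; apply: measurableI; apply: measurable_fiber.
apply/seteqP; split => [w /= <- l _//|w h]; rewrite /= /state_at.
case: x h => x1 x2 h; congr pair; apply/funext => l; by have [] := h l I.
Qed.

Lemma measurable_pvec (X : L -> {RV P >-> nat}) (a : pvec L) :
  measurable [set w | (fun l => X l w) = a].
Proof.
rewrite (_ : [set w | _] = \bigcap_(l in [set: L]) (X l @^-1` [set a l])).
  apply: fin_bigcap_measurable; first exact: finite_finset.
  by move=> l _; apply: measurable_fiber.
apply/seteqP; split => [w /= <- l _//|w h]; apply/funext => l; exact: h.
Qed.

Variables (k : nat) (x : state R L).
Hypothesis Sx : S x.
Let D := state_at Z k @^-1` [set x].
Let mD : measurable D := measurable_state k x.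

Let Y w := (arr_at Z k w, chan_at Z k w).
Let mY ac : measurable (Y @^-1` [set ac]).
Proof.
rewrite (_ : _ @^-1` _ = [set w | arr_at Z k w = ac.1] `&` [set w | chan_at Z k w = ac.2]).
  by apply: measurableI; exact: measurable_pvec.
by apply/seteqP; split => w; case: ac => a c; rewrite /Y /= => -[-> ->].
Qed.

(** Independence of the frame from the whole history becomes independence from the current state by
    summing out the past. *)
Lemma driving_given_state a c :
  P (D `&` Y @^-1` [set (a, c)]) = (P D * (arr_law N a * chan_law N c)%:E)%E.
Proof.
apply: (@marginal_product_rule _ _ _ P _ S (state_at Z) cS measurable_state
    (chain_markov hZ).1 k _ (fun=> arr_law N a * chan_law N c)) => //.
  by move=> y _; rewrite mulr_ge0.
move=> p _; have := driving_indep hZ k p a c => <-; congr (P _).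
by apply/seteqP; split => w; rewrite /Y /= => -[h1 h2]; split => //; case: h2 => -> ->.
Qed.

Let countable_pvec2 : countable [set: pvec L * pvec L].
Proof. by rewrite -setXTT; apply: countableX; exact: countable_pvec. Qed.

Lemma integral_driving (phi : pvec L * pvec L -> R) : (forall ac, 0 <= phi ac) ->
  (\int[P]_(w in D) (phi (Y w))%:E =
  P D * \esum_(ac in [set: pvec L * pvec L])
     (phi ac * (arr_law N ac.1 * chan_law N ac.2))%:E)%E.
Proof.
move=> phi0.
rewrite (@integral_countable _ _ _ P _ Y setT countable_pvec2 (fun ac _ => mY ac)
  (EFin \o phi))//; last by move=> ac _; rewrite lee_fin.
rewrite -[P D]fineK ?fin_num_measure// -esumZl ?fine_ge0//; last first.
  by move=> ac _; rewrite lee_fin !mulr_ge0.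
apply: eq_esum => -[a c] _ /=; rewrite driving_given_state fineK ?fin_num_measure//.
by rewrite muleCA -EFinM.
Qed.

Lemma measurable_fun_driving (phi : pvec L * pvec L -> R) : measurable_fun D (phi \o Y).
Proof. exact: (measurable_fun_countable countable_pvec2 (fun ac _ => mY ac)). Qed.

Lemma mean_le_driving (psi chi : pvec L -> R) (s t : R) :
  (forall v, 0 <= psi v) -> (forall v, 0 <= chi v) ->
  \esum_(v in [set: pvec L]) (psi v * arr_law N v)%:E = s%:E ->
  \esum_(v in [set: pvec L]) (chi v * chan_law N v)%:E = t%:E ->
  mean_le P D (fun w => psi (arr_at Z k w) * chi (chan_at Z k w)) (s * t).
Proof.
move=> psi0 chi0 hs ht; split.
- exact: (measurable_fun_driving (fun ac => psi ac.1 * chi ac.2)).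
- by move=> w; rewrite mulr_ge0.
- rewrite (@integral_driving (fun ac => psi ac.1 * chi ac.2)); last first.
    by move=> ac; rewrite mulr_ge0.
  rewrite muleC lee_wpmul2r//.
  rewrite -setXTT -[[set: pvec L] `*` _]/([set: pvec L] `*`` (fun=> [set: pvec L])).
  rewrite -(@esum_esum _ _ _ setT (fun=> setT) (fun a c =>
    (psi a * chi c * (arr_law N a * chan_law N c))%:E)); last first.
    by move=> a c _ _; rewrite lee_fin !mulr_ge0.
  have t0 : 0 <= t.
    by rewrite -lee_fin -ht; apply: esum_ge0 => v _; rewrite lee_fin mulr_ge0.
  rewrite (_ : \esum_(i in _) _ = \esum_(a in [set: pvec L]) (t%:E * (psi a * arr_law N a)%:E))%E.
    rewrite esumZl// ?hs -?EFinM 1?mulrC//.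
    by move=> v _; rewrite lee_fin mulr_ge0.
  apply: eq_esum => a _; rewrite -ht muleC -esumZl ?mulr_ge0//; last first.
    by move=> v _; rewrite lee_fin mulr_ge0.
  by apply: eq_esum => c _; rewrite -EFinM; congr EFin; ring.
Qed.

Lemma mean_le_arr2 l :
  mean_le P D (fun w => (arr Z k l w)%:R ^+ 2) (lam N l ^+ 2 + sigma_i N l ^+ 2).
Proof.
have := @mean_le_driving (fun v => (v l)%:R ^+ 2) (fun=> 1) _ 1 _ _
  (second_moment (arr_pmf hN) (arr_mean hN l) (arr_var hN l)).
rewrite mulr1; under [X in mean_le _ _ X]eq_fun do rewrite mulr1.
apply => //.
by rewrite -[RHS](chan_pmf hN).2; apply: eq_esum => v _; rewrite mul1r.
Qed.

Lemma mean_le_arr1 l : mean_le P D (fun w => (arr Z k l w)%:R) (lam N l).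
Proof.
have := @mean_le_driving (fun v => (v l)%:R) (fun=> 1) _ 1 _ _ (arr_mean hN l).
rewrite mulr1; under [X in mean_le _ _ X]eq_fun do rewrite mulr1.
apply => //.
by rewrite -[RHS](chan_pmf hN).2; apply: eq_esum => v _; rewrite mul1r.
Qed.

Lemma mean_le_chan2 l :
  mean_le P D (fun w => (chan Z k l w)%:R ^+ 2) (cbar N l ^+ 2 + sigma_c N l ^+ 2).
Proof.
have := @mean_le_driving (fun=> 1) (fun v => (v l)%:R ^+ 2) 1 _ _ _ _
  (second_moment (chan_pmf hN) (chan_mean hN l) (chan_var hN l)).
rewrite mul1r; under [X in mean_le _ _ X]eq_fun do rewrite mul1r.
apply => //.
by rewrite -[RHS](arr_pmf hN).2; apply: eq_esum => v _; rewrite mul1r.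
Qed.

Let q l := 1 - loss N l.
Let q01 l : 0 <= q l <= 1. Proof. by have := loss01 hN l; rewrite /q; lra. Qed.

(** [h n] is the mean of [g] under the binomial thinning of [n] arrivals, so moments of the thinned
    arrivals reduce to moments of the arrivals. *)
Lemma mean_le_thinning l (g h : nat -> R) m : (forall j, 0 <= g j) ->
  (forall n, \sum_(j < n.+1) g j * binomial_pmf n (q l) j = h n) ->
  mean_le P D (fun w => h (arr Z k l w)) m ->
  mean_le P D (fun w => g (tarr_i Z k l w)) m.
Proof.
move=> g0 gh [_ h0 hm].
have mA n : measurable (arr Z k l @^-1` [set n]) by exact: measurable_fiber.
have mT n : measurable (tarr_i Z k l @^-1` [set n]) by exact: measurable_fiber.
have hn0 n : 0 <= h n.
  by rewrite -gh; apply: sumr_ge0 => j _; rewrite mulr_ge0// binomial_pmf_ge0.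
pose W w := (arr Z k l w, tarr_i Z k l w).
have mW p : measurable (W @^-1` [set p]).
  rewrite (_ : _ @^-1` _ = arr Z k l @^-1` [set p.1] `&` tarr_i Z k l @^-1` [set p.2]).
    exact: measurableI.
  by apply/seteqP; split => w; case: p => a c; rewrite /W /= => -[-> ->].
split => //.
- exact: (@measurable_fun_countable _ _ _ _ setT (countableP _) (fun n _ => mT n) _ _ g).
apply: le_trans hm.
rewrite (@integral_countable _ _ _ P _ W setT (countableP _) (fun p _ => mW p)
  (fun p => (g p.2)%:E))//; last by move=> p _; rewrite lee_fin.
rewrite (@integral_countable _ _ _ P _ (arr Z k l) setT (countableP _) (fun p _ => mA p)
  (EFin \o h))//; last by move=> p _; rewrite lee_fin.
rewrite -setXTT -[[set: nat] `*` _]/([set: nat] `*`` (fun=> [set: nat])).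
rewrite (@eq_esum _ _ _ _ (fun p => (g p.2)%:E * P (D `&` W @^-1` [set (p.1, p.2)]))%E);
  last by case.
rewrite -(@esum_esum _ _ _ setT (fun=> setT) (fun n j =>
  ((g j)%:E * P (D `&` W @^-1` [set (n, j)]))%E)); last first.
  by move=> n j _ _; rewrite mule_ge0// lee_fin.
apply: le_esum => n _.
have pf : P (D `&` arr Z k l @^-1` [set n]) =
    (fine (P (D `&` arr Z k l @^-1` [set n])))%:E.
  by rewrite fineK// fin_num_measure//; exact: measurableI.
rewrite (_ : \esum_(j in _) _ = \esum_(j in [set: nat])
    (fine (P (D `&` arr Z k l @^-1` [set n])))%:E * (g j * binomial_pmf n (q l) j)%:E)%E.
  rewrite esumZl ?fine_ge0//; last by move=> j _; rewrite lee_fin mulr_ge0// binomial_pmf_ge0.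
  by rewrite esum_binomial_pmf// gh -pf muleC.
apply: eq_esum => j _; rewrite -pf EFinM muleCA; congr (_ * _)%E.
have := tarr_i_law hZ k l x n j => <-; congr (P _).
by apply/seteqP; split => w; rewrite /W /= => -[? []]; [move=> -> ->|move=> -> ->].
Qed.

Lemma mean_le_tarr1 l : mean_le P D (fun w => (tarr_i Z k l w)%:R) (q l * lam N l).
Proof.
apply: (@mean_le_thinning l (fun j => j%:R) (fun n => q l * n%:R)) => //.
  by move=> n; rewrite binomial_moment1 mulrC.
by apply: mean_leZ; [exact: mD|case/andP: (q01 l)|exact: mean_le_arr1].
Qed.

Lemma mean_le_tarr2 l : mean_le P D (fun w => (tarr_i Z k l w)%:R ^+ 2)
  (q l * (1 - q l) * lam N l + q l ^+ 2 * (lam N l ^+ 2 + sigma_i N l ^+ 2)).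
Proof.
apply: (@mean_le_thinning l (fun j => j%:R ^+ 2)
    (fun n => q l * (1 - q l) * n%:R + q l ^+ 2 * n%:R ^+ 2)).
- by move=> j; exact: sqr_ge0.
- by move=> n; rewrite binomial_moment2; ring.
- have /andP[q0 q1] := q01 l; apply: mean_leD => //; apply: mean_leZ => //.
  + by rewrite mulr_ge0// subr_ge0.
  + exact: mean_le_arr1.
  + exact: sqr_ge0.
  + exact: mean_le_arr2.
Qed.

Let y l := controller Z x l.
Let y0X l : 0 <= y l <= Xmax. Proof. exact: (controllerP hZ Sx l).1. Qed.

Let meas_tarr_e l : measurable_fun D (fun w => (tarr_e Z k l w)%:R : R).
Proof.
have mT n : measurable (tarr_e Z k l @^-1` [set n]) by exact: measurable_fiber.
exact: (@measurable_fun_countable _ _ _ _ setT (countableP _) (fun n _ => mT n) _ _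
  (fun n => n%:R : R)).
Qed.

Lemma mean_le_tarr_e1 l : mean_le P D (fun w => (tarr_e Z k l w)%:R) (y l).
Proof. by split => //; rewrite (tarr_e_mean hZ k l Sx). Qed.

Lemma mean_le_tarr_e2 l :
  mean_le P D (fun w => (tarr_e Z k l w)%:R ^+ 2) (Xmax ^+ 2 + sigma_e ^+ 2).
Proof.
have /andP[yl0 ylX] := y0X l.
split; [exact: measurable_funX|by move=> w; exact: sqr_ge0|].
have [mg _ g1] := mean_le_tarr_e1 l.
have pf : P D = (fine (P D))%:E by rewrite fineK// fin_num_measure.
(* Mean square written without subtraction, before it is known to be finite; the mean is
   [y l <= Xmax] and the variance at most [sigma_e ^+ 2]. *)
have e : (\int[P]_(w in D) ((tarr_e Z k l w)%:R ^+ 2)%:E + (y l ^+ 2)%:E * P D =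
    \int[P]_(w in D) (((tarr_e Z k l w)%:R - y l) ^+ 2)%:E +
    (2 * y l)%:E * ((y l)%:E * P D))%E.
  have me : (\int[P]_(w in D) ((tarr_e Z k l w)%:R)%:E = (y l)%:E * P D)%E.
    exact: tarr_e_mean hZ k l x Sx.
  rewrite -me -integral_cst//.
  rewrite -ge0_integralZl_EFin ?mulr_ge0//; last exact/measurable_EFinP.
  rewrite -!ge0_integralD//; try by move=> w _; rewrite lee_fin sqr_ge0.
  - by apply: eq_integral => w _; rewrite -!EFinM -!EFinD; congr EFin; ring.
  - by apply/measurable_EFinP/measurable_funX/measurable_funB.
  - by move=> w _; rewrite -EFinM lee_fin !mulr_ge0.
  - by apply/measurable_EFinP; apply: measurable_funM.
  - exact/measurable_EFinP/measurable_funX.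
have v : (\int[P]_(w in D) (((tarr_e Z k l w)%:R - y l) ^+ 2)%:E <=
    (sigma_e ^+ 2)%:E * P D)%E by exact: tarr_e_var hZ k l x Sx.
have p0 : 0 <= fine (P D) by exact: fine_ge0.
have sq : y l ^+ 2 <= Xmax ^+ 2 by rewrite lerXn2r// nnegrE (le_trans yl0).
have J0 : (0 <= \int[P]_(w in D) (((tarr_e Z k l w)%:R - y l) ^+ 2)%:E)%E.
  by apply: integral_ge0 => w _; rewrite lee_fin sqr_ge0.
move: e v J0; rewrite pf -!EFinM.
case: (\int[P]_(w in D) ((tarr_e Z k l w)%:R ^+ 2)%:E)%E => [t1| |];
  case: (\int[P]_(w in D) (((tarr_e Z k l w)%:R - y l) ^+ 2)%:E)%E => [t2| |]//.
rewrite -!EFinD => -[e]; rewrite !lee_fin => v _.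
have : y l ^+ 2 * fine (P D) <= Xmax ^+ 2 * fine (P D) by rewrite ler_wpM2r.
lra.
Qed.

(** Random majorant, per link, of the Lyapunov increment plus the schedule weight. The first two
    lines average to the summands of [B1]; the term with [weight] bounds the reward of the scheduled
    inelastic packets, which never exceed the arrivals. *)
Let G l w : R :=
  2^-1 * ((tarr_i Z k l w)%:R ^+ 2 + (arr Z k l w)%:R ^+ 2)
  + 2^-1 * ((tarr_e Z k l w)%:R ^+ 2 + (slots N)%:R ^+ 2 * (chan Z k l w)%:R ^+ 2)
  + (x.1 l * (tarr_i Z k l w)%:R + x.2 l * (tarr_e Z k l w)%:R
     + eps^-1 * weight N l * (arr Z k l w)%:R).

Hypothesis eps0 : 0 < eps.

Let x1 l : 0 <= x.1 l. Proof. by have [] := space_ge0 hZ Sx l. Qed.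
Let x2 l : 0 <= x.2 l. Proof. by have [] := space_ge0 hZ Sx l. Qed.
Let ew0 l : 0 <= eps^-1 * weight N l.
Proof. by rewrite mulr_ge0 ?(weight_ge0 hN)// invr_ge0 ltW. Qed.

Lemma lyapunov_step_le w : D w ->
  lyapunov (state_at Z k.+1 w) +
    sched_weight eps x (scheduler Z (arr_at Z k w) (chan_at Z k w) x) <=
  lyapunov x + \sum_l G l w.
Proof.
move=> Dw; pose s := scheduler Z (arr_at Z k w) (chan_at Z k w) x.
have [fs _] := schedulerP hZ (arr_at Z k w) (chan_at Z k w) Sx.
rewrite -/s /lyapunov /sched_weight !mulr_sumr -!big_split /=.
apply: ler_sum => l _; rewrite (deficitS hZ) (queueS hZ).
have -> : schedule_at Z k w = s by rewrite /schedule_at (Dw : state_at Z k w = x).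
have <- : x.1 l = deficit Z k l w by rewrite -(Dw : state_at Z k w = x).
have <- : x.2 l = queue Z k l w by rewrite -(Dw : state_at Z k w = x).
have Ia : (inel_total s l)%:R <= (arr Z k l w)%:R :> R.
  by rewrite ler_nat; case: fs => _ + _; apply.
have Jc : (el_total s l)%:R <= (slots N)%:R * (chan Z k l w)%:R :> R.
  by rewrite -natrM ler_nat; exact: el_total_le fs.
have e1 := reflected_step_le (x1 l) (ler0n R (tarr_i Z k l w)) (ler0n R _) Ia.
have e2 := reflected_step_le (x2 l) (ler0n R (tarr_e Z k l w)) (ler0n R _) Jc.
have e3 : eps^-1 * weight N l * (inel_total s l)%:R <=
    eps^-1 * weight N l * (arr Z k l w)%:R by rewrite ler_wpM2l.
rewrite /G; rewrite exprMn in e2; lra.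
Qed.

Let mG l : R :=
  2^-1 * ((q l * (1 - q l) * lam N l + q l ^+ 2 * (lam N l ^+ 2 + sigma_i N l ^+ 2))
     + (lam N l ^+ 2 + sigma_i N l ^+ 2))
  + 2^-1 * ((Xmax ^+ 2 + sigma_e ^+ 2)
     + (slots N)%:R ^+ 2 * (cbar N l ^+ 2 + sigma_c N l ^+ 2))
  + (x.1 l * (q l * lam N l) + x.2 l * y l + eps^-1 * weight N l * lam N l).

Let mean_le_G l : mean_le P D (G l) (mG l).
Proof.
have h0 : 0 <= (2^-1 : R) by rewrite invr_ge0.
apply: mean_leD => //; first apply: mean_leD => //.
- apply: mean_leZ => //; apply: mean_leD => //; [exact: mean_le_tarr2|exact: mean_le_arr2].
- apply: mean_leZ => //; apply: mean_leD => //; first exact: mean_le_tarr_e2.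
  by apply: mean_leZ => //; exact: mean_le_chan2.
- apply: mean_leD => //; first apply: mean_leD => //.
  + by apply: mean_leZ => //; exact: mean_le_tarr1.
  + by apply: mean_leZ => //; exact: mean_le_tarr_e1.
  + by apply: mean_leZ => //; exact: mean_le_arr1.
Qed.

Let V := @lyapunov R L.

Lemma lyapunov_ge0 (z : state R L) : 0 <= lyapunov z.
Proof.
rewrite /lyapunov mulr_ge0 ?invr_ge0// sumr_ge0// => l _.
by rewrite addr_ge0// sqr_ge0.
Qed.

Lemma measurable_lyapunov j (E : set Om) : measurable_fun E (fun w => lyapunov (state_at Z j w)).
Proof.
apply: measurable_funM => //; apply: measurable_sum => l.
by apply: measurable_funD; apply: measurable_funX; apply: measurable_funTS;
  exact: measurable_funP.
Qed.

(** Keeping only the outcomes whose next state lies in [S] discards a nonnegative amount and leaves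
    a sum over a countable set. *)
Lemma kop_lyapunov_le_integral :
  (P D * kop S K (EFin \o V) x <= \int[P]_(w in D) (V (state_at Z k.+1 w))%:E)%E.
Proof.
pose E := D `&` state_at Z k.+1 @^-1` S.
have mS := measurable_preimage_countable cS (fun z _ => measurable_state k.+1 z).
have mE : measurable E by exact: measurableI.
apply: (@le_trans _ _ (\int[P]_(w in E) (V (state_at Z k.+1 w))%:E)%E); last first.
  apply: ge0_subset_integral => //.
  - exact/measurable_EFinP/measurable_lyapunov.
  - by move=> w _; rewrite lee_fin lyapunov_ge0.
  - by move=> w [].
have -> : (\int[P]_(w in E) (V (state_at Z k.+1 w))%:E =
    \esum_(z in S) ((V z)%:E * P (E `&` state_at Z k.+1 @^-1` [set z])))%E.
  apply: (@integral_countable _ _ _ P _ _ S cS (fun z _ => measurable_state k.+1 z)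
    (EFin \o V)) => //; last by move=> z _; rewrite lee_fin lyapunov_ge0.
  by move=> w [].
rewrite -[P D]fineK ?fin_num_measure// /kop /wsum -esumZl ?fine_ge0//; last first.
  move=> z Sz; rewrite mule_ge0// lee_fin ?lyapunov_ge0//; exact: (hK Sx).1.
apply: le_esum => z Sz; rewrite fineK ?fin_num_measure//.
have := markov_one_step cS measurable_state (chain_markov hZ).1 hK (chain_markov hZ) k Sx Sz.
rewrite -/D => e; rewrite muleA -[(P D * _)%E]e muleC.
rewrite le_eqVlt; apply/orP; left; apply/eqP; congr (_ * P _)%E.
by apply/seteqP; split => [w [Dw zw]|w [[Dw _] zw]]; split => //; split => //=; rewrite zw.
Qed.

(** Integrating the one-step bound over [D], the scheduler's weight is at least the static value;
    positivity of [P D] allows dividing by it. *)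
Lemma kop_lyapunov_le (v : static_vars N) : static_feasible v -> (0 < P D)%E ->
  (kop S K (EFin \o V) x +
    (\sum_l ((eps^-1 * weight N l + x.1 l) * mu_i v l + x.2 l * mu_e v l))%:E
   <= (V x + \sum_l mG l)%:E)%E.
Proof.
move=> hv PD.
pose sw (ac : pvec L * pvec L) := sched_weight eps x (scheduler Z ac.1 ac.2 x).
have sw0 ac : 0 <= sw ac by exact: (sched_weight_ge0 hN eps0 x1 x2 (schedulerP hZ _ _ Sx)).
have [mr r0 hr] : mean_le P D (fun w => V x + \sum_l G l w) (V x + \sum_l mG l).
  apply: mean_leD => //; first by apply: mean_le_cst => //; exact: lyapunov_ge0.
  exact: mean_le_sum.
have mV : measurable_fun D (fun w => (V (state_at Z k.+1 w))%:E).
  exact/measurable_EFinP/measurable_lyapunov.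
have mW : measurable_fun D (fun w => (sw (Y w))%:E).
  exact/measurable_EFinP/(measurable_fun_driving sw).
have step : (\int[P]_(w in D) (V (state_at Z k.+1 w))%:E +
   \int[P]_(w in D) (sw (Y w))%:E <= (V x + \sum_l mG l)%:E * P D)%E.
  rewrite -ge0_integralD//; last 2 first.
  - by move=> w _; rewrite lee_fin lyapunov_ge0.
  - by move=> w _; rewrite lee_fin.
  apply: le_trans hr; apply: ge0_le_integral => //.
  - by move=> w _; rewrite -EFinD lee_fin addr_ge0// lyapunov_ge0.
  - exact: emeasurable_funD.
  - exact/measurable_EFinP.
  - by move=> w Dw; rewrite -EFinD lee_fin; exact: lyapunov_step_le.
have low : (P D * (\sum_l ((eps^-1 * weight N l + x.1 l) * mu_i v l + x.2 l * mu_e v l))%:E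
    <= \int[P]_(w in D) (sw (Y w))%:E)%E.
  rewrite integral_driving// lee_wpmul2l//.
  exact: (static_le_mean_argmax hN hv eps0 x1 x2 (fun a c => schedulerP hZ a c Sx)).
have := le_trans (leeD kop_lyapunov_le_integral low) step.
rewrite [X in (_ <= X)%E -> _]muleC -[P D]fineK ?fin_num_measure//.
have p0 : 0 < fine (P D) by rewrite fine_gt0// PD ltey_eq fin_num_measure//.
have k0 : (0 <= kop S K (EFin \o V) x)%E.
  by apply: (kop_ge0 hK) => // z _; rewrite lee_fin lyapunov_ge0.
case: (kop S K (EFin \o V) x) k0 => [t _|_|//].
  by rewrite -!EFinM -!EFinD !lee_fin -mulrDr ler_pM2l.
by rewrite gt0_muley ?lte_fin// -EFinM addye// leye_eq.
Qed.

Hypotheses (v : static_vars N) (hv : static_feasible v).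
Hypothesis hX : forall l, rate v l < Xmax.

(** The slack of the inelastic rates turns [x.1] times arrivals minus service into [- m * x.1]. For
    the elastic queues, controller optimality replaces the controller's rate by [rate v] at the cost
    of a utility difference over [eps], and the slack of [mu_e] then gives [- m * x.2]. *)
Lemma lyapunov_drift (m : R) : (0 < P D)%E ->
  (forall l, m <= mu_i v l - lam N l * (1 - loss N l)) ->
  (forall l, m <= mu_e v l - rate v l) ->
  (kop S K (EFin \o V) x + (m * \sum_l (x.1 l + x.2 l))%:E <=
   (V x + (B1 N Xmax sigma_e + eps^-1 *
     \sum_l (sup [set 2 * `|util N l t| | t in `[0%R, Xmax]] + weight N l * lam N l)))%:E)%E.
Proof.
move=> PD m1 m2; have := kop_lyapunov_le hv PD.
set M := \sum_l (_ * mu_i v l + _ * _); set kV := kop _ _ _ _ => h.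
have key : V x + \sum_l mG l + m * \sum_l (x.1 l + x.2 l) <=
    V x + (B1 N Xmax sigma_e + eps^-1 *
     \sum_l (sup [set 2 * `|util N l t| | t in `[0%R, Xmax]] + weight N l * lam N l)) + M.
  rewrite -!addrA lerD2l /B1 /M !mulr_sumr -!big_split /=; apply: ler_sum => l _.
  have /andP[q0 q1] := q01 l.
  have [yb ymax] := controllerP hZ Sx l.
  have rb : 0 <= rate v l <= Xmax.
    by have /andP[r0 _] := rate_bounds hv l; rewrite r0 ltW.
  have o := ymax _ rb.
  have b := concave_diff_le_sup (util_concave hN l) yb rb.
  have b' : eps^-1 * (util N l (controller Z x l) - util N l (rate v l)) <=
     eps^-1 * sup [set 2 * `|util N l t| | t in `[0%R, Xmax]].
    by rewrite ler_wpM2l// invr_ge0 ltW.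
  have c1 : x.1 l * m <= x.1 l * (mu_i v l - lam N l * (1 - loss N l)) by rewrite ler_wpM2l.
  have c2 : x.2 l * m <= x.2 l * (mu_e v l - rate v l) by rewrite ler_wpM2l.
  have mu0 : 0 <= mu_i v l.
    apply: le_trans (mu_i_ge hv l); rewrite mulr_ge0//.
    exact: has_mean_ge0 (arr_pmf hN) _ _ (arr_mean hN l).
  have c3 : 0 <= eps^-1 * weight N l * mu_i v l by rewrite mulr_ge0.
  rewrite /mG /q -/(y l) in o b' *; lra.
have hh : (kV + M%:E + (m * \sum_l (x.1 l + x.2 l))%:E <=
   (V x + \sum_l mG l)%:E + (m * \sum_l (x.1 l + x.2 l))%:E)%E by rewrite leeD2r.
move: hh; rewrite addeAC; case: kV h => [t _|//=|_ _]; last exact: leNye.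
by rewrite -!EFinD !lee_fin; lra.
Qed.

End Drift.

(** * Finite sublevel sets and the main bound *)

Section FiniteSublevel.
Context {R : realType} {L : finType}.
Variable N : network R L.
Variables (d : measure_display) (Om : measurableType d) (P : probability Om R).
Variables (Z : process N P) (eps Xmax sigma_e : R).
Hypothesis hZ : online eps Xmax sigma_e Z.

Let S := chain_space Z.
Let K := chain_kernel Z.

(* Each counter moves by integer steps until its first truncation at [0], and is
   an integer from then on. *)
Definition lattice_reachable (u t : R) : Prop := t \is a Num.int \/ t - u \is a Num.int.

Lemma lattice_reachable_trans u t s :
  lattice_reachable u t -> lattice_reachable t s -> lattice_reachable u s.
Proof.
move=> [ut|ut] [ts|ts]; [by left|left|by left|right].
  by rewrite -(subrK t s) rpredD.
by rewrite -(subrKA t) rpredD.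
Qed.

Lemma lattice_reachable_step u (m n : nat) :
  lattice_reachable u (Num.max (u + m%:R - n%:R) 0).
Proof.
case: (leP (u + m%:R - n%:R) 0) => _; first by left; rewrite rpred0.
right; have -> : u + m%:R - n%:R - u = m%:R - n%:R by ring.
by rewrite rpredB ?rpred_nat.
Qed.

(** A transition of positive probability occurs at an actual sample point of the process, where the
    update rules apply. *)
Lemma kernel_step_lattice x z : S x -> S z -> 0 < K x z -> forall l,
  lattice_reachable (x.1 l) (z.1 l) /\ lattice_reachable (x.2 l) (z.2 l).
Proof.
move=> Sx Sz Kxz l; have cS := space_countable hZ.
have [aeS markovZ] := chain_markov hZ; have hK := chain_transition hZ.
have mZ j y : measurable (state_at Z j @^-1` [set y]) by exact: measurable_state.
have [k lk] := law_pos cS mZ aeS hK (chain_markov hZ)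
  (chain_irreducible hZ) Sx.
have : (0 < P (state_at Z k @^-1` [set x] `&` state_at Z k.+1 @^-1` [set z]))%E.
  rewrite (markov_one_step cS mZ aeS hK (chain_markov hZ))//.
  by rewrite -(lawE mZ) -EFinM lte_fin mulr_gt0.
have [[w [/= xw zw]]|no] := pselect (exists w,
    (state_at Z k @^-1` [set x] `&` state_at Z k.+1 @^-1` [set z]) w); last first.
  rewrite (_ : _ `&` _ = set0) ?measure0 ?ltxx//.
  by apply/seteqP; split => // w hw; apply: no; exists w.
move=> _; rewrite -xw -zw /= (deficitS hZ) (queueS hZ).
by split; exact: lattice_reachable_step.
Qed.

Lemma space_lattice x z : S x -> S z -> forall l,
  lattice_reachable (x.1 l) (z.1 l) /\ lattice_reachable (x.2 l) (z.2 l).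
Proof.
move=> Sx Sz; have [n] := chain_irreducible hZ Sx Sz.
elim: n x Sx => [|n ih] x Sx.
  rewrite /=; have [-> _ l|] := eqVneq x z; last by rewrite ltxx.
  by split; right; rewrite subrr rpred0.
move=> /(kstepS_gt0 (chain_transition hZ) Sx)[t [St Kxt ktz]] l.
have [a1 a2] := kernel_step_lattice Sx St Kxt l; have [b1 b2] := ih t St ktz l.
by split; [exact: lattice_reachable_trans a1 b1|exact: lattice_reachable_trans a2 b2].
Qed.

Lemma finite_int_ball (B : R) : finite_set [set t : R | t \is a Num.int /\ `|t| <= B].
Proof.
pose n := (Num.truncn B).+1.
apply: (@sub_finite_set _ _
  ((fun p : bool * 'I_n.+1 => (-1) ^+ p.1 * p.2%:R) @` [set: bool * 'I_n.+1])); last first.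
  by apply: finite_image; exact: finite_finset.
move=> t [/intrP[z ->] zB].
have zn : (`|z| < n.+1)%N.
  have : (`|z|%N%:R : R) <= B by rewrite natr_absz intr_norm.
  by move=> h; rewrite ltnS -(ler_nat R) (le_trans h)// ltW// /n truncnS_gt.
exists (z < 0, Ordinal zn) => //=.
by rewrite [in RHS](intEsign z) rmorphM /= rmorph_sign.
Qed.

Lemma finite_lattice_ball (u B : R) :
  finite_set [set t | lattice_reachable u t /\ `|t| <= B].
Proof.
apply: (@sub_finite_set _ _ ([set t : R | t \is a Num.int /\ `|t| <= B] `|`
   ((fun t => t + u) @` [set t : R | t \is a Num.int /\ `|t| <= B + `|u|]))); last first.
  rewrite finite_setU; split; first exact: finite_int_ball.
  by apply: finite_image; exact: finite_int_ball.
move=> t [[ti|ti] tB]; [by left|right].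
by exists (t - u); rewrite ?subrK//; split => //; rewrite (le_trans (ler_normB _ _))// lerD2r.
Qed.

Lemma finite_states (F : L -> set R) : (forall l, finite_set (F l)) ->
  finite_set [set x : state R L | forall l, F l (x.1 l) /\ F l (x.2 l)].
Proof.
move=> finF; pose s l := finmap.enum_fset (fset_set (F l)).
pose B := (\sum_l size (s l))%N.
pose T := {ffun L -> 'I_B.+1}.
pose phi (fg : T * T) : state R L :=
  (fun l => nth 0 (s l) (fg.1 l), fun l => nth 0 (s l) (fg.2 l)).
apply: (@sub_finite_set _ _ (phi @` [set: T * T])); last first.
  by apply: finite_image; exact: finite_finset.
move=> [x1 x2] /= hx.
have ms l t : F l t -> t \in s l by move=> Ft; rewrite in_fset_set// inE.
have ix l t : F l t -> (index t (s l) < B.+1)%N.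
  by move=> Ft; rewrite ltnS (leq_trans (index_size _ _))// /B (bigD1 l)//= leq_addr.
pose fg : T * T := ([ffun l => inord (index (x1 l) (s l))],
                    [ffun l => inord (index (x2 l) (s l))]).
exists fg => //; rewrite /phi /=; congr pair; apply/funext => l; have [h1 h2] := hx l.
  by rewrite ffunE inordK ?nth_index ?ms ?ix.
by rewrite ffunE inordK ?nth_index ?ms ?ix.
Qed.

Lemma finite_backlog_sublevel (c : R) :
  finite_set [set x | S x /\ \sum_l (x.1 l + x.2 l) <= c].
Proof.
have [[x0 Sx0]|no] := pselect (exists x, S x); last first.
  by rewrite (_ : [set x | _] = set0)//; apply/seteqP; split => // x [Sx _]; apply: no; exists x.
(* The union gives one finite set per link that serves for both the deficit and the queue. *)
pose F l := [set t | lattice_reachable (x0.1 l) t /\ `|t| <= c] `|`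
            [set t | lattice_reachable (x0.2 l) t /\ `|t| <= c].
apply: (@sub_finite_set _ _ [set x : state R L | forall l, F l (x.1 l) /\ F l (x.2 l)]); last first.
  apply: finite_states => l; rewrite finite_setU.
  by split; exact: finite_lattice_ball.
move=> x [Sx xc] l; have [h1 h2] := space_lattice Sx0 Sx l.
have nn j : 0 <= x.1 j /\ 0 <= x.2 j := space_ge0 hZ Sx j.
have hl : x.1 l + x.2 l <= c.
  apply: le_trans xc; rewrite (bigD1 l)//= lerDl sumr_ge0// => j _.
  by have [? ?] := nn j; rewrite addr_ge0.
have [n1 n2] := nn l.
by split; [left|right]; split => //; rewrite ger0_norm//; lra.
Qed.

End FiniteSublevel.

Section MinLinks.
Context {R : realType} {L : finType}.
Variable F : L -> R.

Lemma min_links_le l : min_links F <= F l.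
Proof.
apply: ge_inf; last by exists l.
exists (- \sum_j `|F j|) => _ [j _ <-].
rewrite lerNl (le_trans (ler_norm _))// normrN (bigD1 j)//= lerDl.
by apply: sumr_ge0.
Qed.

Lemma min_links_gt0 (l0 : L) : (forall l, 0 < F l) -> 0 < min_links F.
Proof.
move=> F0; case: (@arg_minP _ _ _ l0 xpredT F isT) => l _ lmin.
apply: lt_le_trans (F0 l) _; apply: lb_le_inf; first by exists (F l), l.
by move=> _ [j _ <-]; exact: lmin.
Qed.

End MinLinks.

(** The state lies in the chain space only almost surely; the exceptional event is null and drops
    out of the integral. *)
Lemma expectation_law (R : realType) (L : finType) (N : network R L)
    (d : measure_display) (Om : measurableType d) (P : probability Om R)
    (Z : process N P) (eps Xmax sigma_e : R) : online eps Xmax sigma_e Z ->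
  forall (phi : state R L -> R) k, (forall x, chain_space Z x -> 0 <= phi x) ->
  measurable_fun setT (fun w => phi (state_at Z k w)) ->
  ('E_P[fun w => phi (state_at Z k w)] =
    wsum (chain_space Z) (law (P := P) (state_at Z) k) (EFin \o phi))%E.
Proof.
move=> hZ phi k phi0 mphi; have cS := space_countable hZ.
have mZ y : measurable (state_at Z k @^-1` [set y]) by exact: measurable_state.
have mS := measurable_preimage_countable cS (fun z _ => mZ z).
have S0 : P (~` (state_at Z k @^-1` chain_space Z)) = 0%E.
  by apply/negligibleP; [exact: measurableC|exact: (chain_markov hZ).1].
set E := state_at Z k @^-1` chain_space Z.
have mE' : measurable (~` E) by exact: measurableC.
have mphiE : measurable_fun setT (fun w => (phi (state_at Z k w))%:E).
  exact/measurable_EFinP.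
rewrite unlock -(setUv E) integral_setU//; last 2 first.
- by rewrite setUv.
- by apply/disj_set2P; rewrite setICr.
rewrite [X in (_ + X)%E]null_set_integral ?adde0//; last exact: measurable_funTS.
transitivity (\esum_(x in chain_space Z)
    ((phi x)%:E * P (E `&` state_at Z k @^-1` [set x]))%E).
  apply: (@integral_countable _ _ _ P _ _ _ cS (fun z _ => mZ z)
    (EFin \o phi)) => //.
apply: eq_esum => x Sx; rewrite (lawE (fun j y => measurable_state Z j y)) muleC; congr (_ * _)%E; congr (P _).
by apply/seteqP; split => [w [_ xw]//|w /= xw]; split => //; rewrite /E /= xw.
Qed.

Theorem corollary1 (R : realType) (L : finType) (N : network R L)
    (hN : network_spec N)
    (v : static_vars N) (hv : static_solution v)
    (hi : forall l, lam N l * (1 - loss N l) < mu_i v l)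
    (he : forall l, rate v l < mu_e v l)
    (Xmax sigma_e : R) (hX : forall l, rate v l < Xmax) :
  exists B5 : R, B5 <= B5_bound v Xmax /\
    forall (eps : R), 0 < eps ->
    forall (d : measure_display) (Om : measurableType d)
      (P : probability Om R) (Z : process N P),
      online eps Xmax sigma_e Z ->
      (limn_esup (mean_backlog Z)
         <= (B4 v Xmax sigma_e + eps^-1 * B5)%:E)%E.
Proof.
(* The bound itself serves as [B5], fixed before [eps] and the process. *)
exists (B5_bound v Xmax); split => // eps eps0 d Om P Z hZ.
have [l0|L0] := pselect (exists l : L, True); last first.
  (* Without links all sums are empty, so backlog and bound are both 0 whatever the infimum over no
     links is. *)
  have sum0 (F : L -> R) : \sum_l F l = 0.
    by apply: big1 => l _; exfalso; apply: L0; exists l.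
  rewrite /B4 /B5_bound /B1 !sum0 !mulr0 addr0 !mul0r mulr0 addr0.
  apply: (@limn_esup_le_near _ _ _ 0%N) => n _; rewrite /mean_backlog.
  under eq_fun do rewrite sum0.
  by rewrite expectation_cst.
have {l0} [l0 _] := l0.
set m := Num.min (B2 v) (B3 v).
have m0 : 0 < m.
  rewrite lt_min /B2 /B3 !(min_links_gt0 l0)//.
    by move=> l; rewrite subr_gt0.
  by move=> l; rewrite subr_gt0.
have m1 l : m <= mu_i v l - lam N l * (1 - loss N l).
  rewrite /m ge_min; apply/orP; left; exact: (min_links_le (fun l => _ - _)).
have m2 l : m <= mu_e v l - rate v l.
  rewrite /m ge_min; apply/orP; right; exact: (min_links_le (fun l => _ - _)).
pose C := \sum_l (sup [set 2 * `|util N l t| | t in `[0%R, Xmax]] + weight N l * lam N l).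
pose b := B1 N Xmax sigma_e + eps^-1 * C.
have -> : B4 v Xmax sigma_e + eps^-1 * B5_bound v Xmax = b / m.
  by rewrite /b mulrDl -mulrA.
have cS := space_countable hZ; have hK := chain_transition hZ.
have mZ k x : measurable (state_at Z k @^-1` [set x]) by exact: measurable_state.
have [aeS markovZ] := chain_markov hZ.
pose f (x : state R L) := \sum_l (x.1 l + x.2 l).
have f0 x : chain_space Z x -> 0 <= f x.
  move=> Sx; apply: sumr_ge0 => l _.
  by have [? ?] := space_ge0 hZ Sx l; rewrite addr_ge0.
have lam0 l : 0 <= lam N l by exact: has_mean_ge0 (arr_pmf hN) _ _ (arr_mean hN l).
have b0 : 0 <= b.
  have h2 : 0 <= (2^-1 : R) by rewrite invr_ge0.
  have sq2 (s t : R) : 0 <= s ^+ 2 + t ^+ 2 by rewrite addr_ge0 ?sqr_ge0.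
  have ieps0 : 0 <= eps^-1 by rewrite invr_ge0 ltW.
  rewrite /b /B1; apply: addr_ge0; first apply: addr_ge0.
  - apply: mulr_ge0 => //; apply: sumr_ge0 => l _; have /andP[p0 p1] := loss01 hN l.
    apply: addr_ge0; apply: mulr_ge0; rewrite ?subr_ge0 ?mulr_ge0//.
    by rewrite addr_ge0 ?sqr_ge0.
  - apply: mulr_ge0 => //; apply: sumr_ge0 => l _.
    by rewrite addr_ge0// mulr_ge0// sqr_ge0.
  apply: mulr_ge0 => //.
  apply: sumr_ge0 => l _; rewrite addr_ge0// ?mulr_ge0 ?(weight_ge0 hN)//.
  have hr : 0 <= rate v l <= Xmax.
    by have /andP[r0 _] := rate_bounds hv.1 l; rewrite r0 ltW.
  (* Comparing a point with itself shows that the supremum is nonnegative. *)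
  by have := concave_diff_le_sup (util_concave hN l) hr hr; rewrite subrr.
have mf k : measurable_fun setT (fun w => f (state_at Z k w)).
  by apply: measurable_sum => l; apply: measurable_funD; exact: measurable_funP.
have -> : mean_backlog Z = fun k => wsum (chain_space Z) (law (P := P) (state_at Z) 0)
    (iter k (kop (chain_space Z) (chain_kernel Z)) (EFin \o f)).
  apply/funext => k; rewrite -(markov_law_iter cS mZ aeS hK (chain_markov hZ)).
    exact: (expectation_law hZ f0 (mf k)).
  by move=> x Sx; rewrite lee_fin f0.
apply: (@limn_esup_foster _ _ _ _ hK _ (@lyapunov R L)) => //.
- exact: chain_irreducible hZ.
- exact: chain_aperiodic hZ.
- by move=> x _; exact: law_ge0.
- exact: law_sum1 cS mZ aeS 0.
- by move=> x _; exact: lyapunov_ge0.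
(* The drift at [x] is obtained from a frame [k] in which the process is at [x] with positive
   probability. *)
- move=> x Sx; have [k lk] := law_pos cS mZ aeS hK (chain_markov hZ)
    (chain_irreducible hZ) Sx.
  apply: (lyapunov_drift hN hZ (k := k) Sx eps0 hv.1) => //.
  by rewrite -(lawE mZ) lte_fin.
- exact: finite_backlog_sublevel hZ.
- rewrite -(expectation_law hZ (phi := @lyapunov R L) (k := 0%N)).
  + exact: initial_moment hZ.
  + by move=> x _; exact: lyapunov_ge0.
  + exact: measurable_lyapunov.
Qed.
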